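(* ($\mathsf{ATR}_0$) Every scattered partial order with no infinite antichains has countably many initial intervals.
   Context: Provability in the subsystem $\mathsf{ATR}_0$ of second-order arithmetic. A partial order $(P,\preceq)$ has $P\subseteq\mathbb{N}$. An antichain is a set of pairwise incomparable elements. An initial interval of $P$ is $I\subseteq P$ with $x\preceq y\in I\Rightarrow x\in I$. $P$ has countably many initial intervals if there is a sequence $\{I_n:n\in\mathbb{N}\}$ (coded by one set) such that every initial interval of $P$ equals some $I_n$. $P$ is scattered if there is no order embedding of $(\mathbb{Q},\le)$ into $P$. *)

(* Defs.v *)
From Stdlib Require Import List Arith.

(** * The language of second-order arithmetic

    De Bruijn syntax, with two separate index spaces: [alln] binds a number
    variable and leaves the set indices alone, [alls] binds a set variable and
    leaves the number indices alone.  A set variable is a bare [nat]. *)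

Inductive term : Type :=
| tvar (n : nat)
| tzero
| tone
| tadd (s t : term)
| tmul (s t : term).

Inductive form : Type :=
| feq (s t : term)
| flt (s t : term)
| fmem (t : term) (X : nat)
| fbot
| fimp (A B : form)
| alln (A : form)
| alls (A : form).

Definition fneg (A : form) : form := fimp A fbot.
Definition ftop : form := fneg fbot.
Definition fand (A B : form) : form := fneg (fimp A (fneg B)).
Definition fdis (A B : form) : form := fimp (fneg A) B.
Definition fiff (A B : form) : form := fand (fimp A B) (fimp B A).
Definition exn (A : form) : form := fneg (alln (fneg A)).
Definition exs (A : form) : form := fneg (alls (fneg A)).

Declare Scope term_scope.
Delimit Scope term_scope with term.
Bind Scope term_scope with term.
Declare Scope form_scope.
Delimit Scope form_scope with form.
Bind Scope form_scope with form.

Notation "# n" := (tvar n) (at level 1, format "# n").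
Notation "0" := tzero : term_scope.
Notation "1" := tone : term_scope.
Notation "s + t" := (tadd s t) : term_scope.
Notation "s * t" := (tmul s t) : term_scope.

Notation "s == t" := (feq s%term t%term)
  (at level 70, no associativity) : form_scope.
Notation "s < t" := (flt s%term t%term) : form_scope.
Notation "s <= t" := (fdis (flt s%term t%term) (feq s%term t%term)) : form_scope.
Notation "t ∈ X" := (fmem t%term X%nat)
  (at level 70, no associativity) : form_scope.
Notation "~ A" := (fneg A) : form_scope.
Notation "A /\ B" := (fand A B) : form_scope.
Notation "A \/ B" := (fdis A B) : form_scope.
Notation "A --> B" := (fimp A B) (at level 90, right associativity) : form_scope.
Notation "A <--> B" := (fiff A B) (at level 95, no associativity) : form_scope.

Fixpoint tsubst (sg : nat -> term) (t : term) : term :=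
  match t with
  | tvar n => sg n
  | tzero => tzero
  | tone => tone
  | tadd s t => tadd (tsubst sg s) (tsubst sg t)
  | tmul s t => tmul (tsubst sg s) (tsubst sg t)
  end.

Definition tshift (d : nat) : term -> term := tsubst (fun k => tvar (d + k)).

Definition scons {A : Type} (a : A) (f : nat -> A) (n : nat) : A :=
  match n with O => a | S m => f m end.

Definition upn (sg : nat -> term) : nat -> term :=
  scons (tvar O) (fun k => tshift (S O) (sg k)).

Definition ups (rh : nat -> nat) : nat -> nat := scons O (fun k => S (rh k)).

(** Simultaneous capture-avoiding substitution: [sg] acts on number variables,
    [rh] on set variables. *)
Fixpoint subst (sg : nat -> term) (rh : nat -> nat) (A : form) : form :=
  match A with
  | feq s t => feq (tsubst sg s) (tsubst sg t)
  | flt s t => flt (tsubst sg s) (tsubst sg t)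
  | fmem t X => fmem (tsubst sg t) (rh X)
  | fbot => fbot
  | fimp A B => fimp (subst sg rh A) (subst sg rh B)
  | alln A => alln (subst (upn sg) rh A)
  | alls A => alls (subst sg (ups rh) A)
  end.

Definition shiftn : form -> form := subst (fun k => tvar (S k)) (fun X => X).
Definition shifts : form -> form := subst tvar S.
Definition instn (t : term) : form -> form := subst (scons t tvar) (fun X => X).
Definition insts (X : nat) : form -> form := subst tvar (scons X (fun Y => Y)).

(** No set quantifiers; free set variables are allowed. *)
Fixpoint arithmetical (A : form) : Prop :=
  match A with
  | fimp A B => arithmetical A /\ arithmetical B
  | alln A => arithmetical A
  | alls _ => False
  | _ => True
  end.

(** * Provability

    Classical two-sorted natural deduction with equality on numbers.  Axioms in
    [T] may contain free variables; as the generalisation rules shift only the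
    assumptions [G], an open axiom stands for its universal closure. *)

Inductive derivable (T : form -> Prop) : list form -> form -> Prop :=
| d_ax G A : T A -> derivable T G A
| d_hyp G A : In A G -> derivable T G A
| d_impI G A B : derivable T (A :: G) B -> derivable T G (fimp A B)
| d_impE G A B : derivable T G (fimp A B) -> derivable T G A -> derivable T G B
| d_raa G A : derivable T (fneg A :: G) fbot -> derivable T G A
| d_allnI G A : derivable T (map shiftn G) A -> derivable T G (alln A)
| d_allnE G A t : derivable T G (alln A) -> derivable T G (instn t A)
| d_allsI G A : derivable T (map shifts G) A -> derivable T G (alls A)
| d_allsE G A X : derivable T G (alls A) -> derivable T G (insts X A)
| d_eqI G t : derivable T G (feq t t)
| d_eqE G A s t :
    derivable T G (feq s t) -> derivable T G (instn s A) ->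
    derivable T G (instn t A).

Definition provable (T : form -> Prop) (A : form) : Prop := derivable T nil A.

Notation "T ⊢ A" := (provable T A%form) (at level 99, no associativity).

(** * Coding

    Below, parameters [P R X f ...] of type [nat] are set indices, and terms
    passed as arguments are shifted explicitly when they go under binders. *)

Definition tpair (s t : term) : term := ((s + t) * (s + t) + s)%term.

Definition rel (R : nat) (s t : term) : form := (tpair s t ∈ R)%form.

(** [f] is a function from [Dom] to [Cod].  [Dom] and [Cod] must not have free
    number variables other than those of their argument. *)
Definition func (Dom Cod : term -> form) (f : nat) : form :=
  ( alln (let z := #0 in
      z ∈ f --> exn (exn (let z := #2 in let x := #1 in let y := #0 in
        z == tpair x y /\ Dom x /\ Cod y)))
    /\
    alln (Dom #0 --> exn (let x := #1 in let y := #0 in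
      tpair x y ∈ f /\
      alln (let x := #2 in let y := #1 in let y' := #0 in
        tpair x y' ∈ f --> y' == y))) )%form.

(** ** Countable well-orders: a set [X] codes the relation [rel X], with field
    {i : (i,i) ∈ X}. *)

Definition ord_field (X : nat) (t : term) : form := rel X t t.

Definition strict (X : nat) (s t : term) : form :=
  (rel X s t /\ ~ rel X t s)%form.

Definition lin_order (X : nat) : form :=
  ( alln (alln (let i := #1 in let j := #0 in
      rel X i j --> rel X i i /\ rel X j j))
    /\ alln (alln (alln (let i := #2 in let j := #1 in let k := #0 in
      rel X i j /\ rel X j k --> rel X i k)))
    /\ alln (alln (let i := #1 in let j := #0 in
      rel X i j /\ rel X j i --> i == j))
    /\ alln (alln (let i := #1 in let j := #0 in
      ord_field X i /\ ord_field X j --> rel X i j \/ rel X j i)) )%form.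

Definition well_order (X : nat) : form :=
  ( lin_order X /\
    ~ exs (let f := O in let X := S X in
        func (fun _ => ftop) (ord_field X) f /\
        alln (alln (alln (let n := #2 in let a := #1 in let b := #0 in
          tpair n a ∈ f /\ tpair (n + 1) b ∈ f --> strict X b a)))) )%form.

(** ** The axioms of ATR_0 *)

(** [A] with every atom [t ∈ Y] replaced by [t ∈ Y^j], where
    Y^j = {(m,i) : i <_X j /\ (m,i) ∈ Y}. *)
Fixpoint restrict (X Y : nat) (j : term) (A : form) : form :=
  match A with
  | fmem t Z =>
      if Nat.eqb Z Y then
        ( t ∈ Y /\
          exn (exn (let m := #1 in let i := #0 in
            tshift 2 t == tpair m i /\ strict X i (tshift 2 j))) )%form
      else fmem t Z
  | fimp A B => fimp (restrict X Y j A) (restrict X Y j B)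
  | alln A => alln (restrict X Y (tshift 1 j) A)
  | alls A => alls (restrict (S X) (S Y) j A)
  | A => A
  end.

(** H_theta(X,Y): X is a linear order and
    Y = {(n,j) : j ∈ field(X) /\ theta(n,Y^j)}.
    In [th], number variable 0 is the element n and set variable 0 is the stage
    Y^j; the remaining variables are parameters.  The result lives in a context
    where set variable 0 is Y and set variable 1 is X (so [th] may mention X as
    set variable 1). *)
Definition hierarchy (th : form) : form :=
  let Y := O in let X := S O in
  ( lin_order X /\
    alln (let z := #0 in
      z ∈ Y <-->
      exn (exn (let z := #2 in let n := #1 in let j := #0 in
        z == tpair n j /\ ord_field X j /\
        restrict X Y j
          (subst (scons n (fun k => tvar (3 + k)%nat)) (fun Z => Z) th)))) )%form.

Inductive ATR0 : form -> Prop :=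
| ax_succ_nonzero : ATR0 (~ #0 + 1 == 0)
| ax_succ_inj : ATR0 (#0 + 1 == #1 + 1 --> #0 == #1)
| ax_add_zero : ATR0 (#0 + 0 == #0)
| ax_add_succ : ATR0 (#0 + (#1 + 1) == (#0 + #1) + 1)
| ax_mul_zero : ATR0 (#0 * 0 == 0)
| ax_mul_succ : ATR0 (#0 * (#1 + 1) == #0 * #1 + #0)
| ax_lt_zero : ATR0 (~ #0 < 0)
| ax_lt_succ : ATR0 (#0 < #1 + 1 <--> #0 < #1 \/ #0 == #1)
| ax_induction :
    ATR0 (0 ∈ 0 /\ alln (#0 ∈ 0 --> #0 + 1 ∈ 0) --> alln (#0 ∈ 0))
| ax_comprehension (A : form) :
    arithmetical A -> ATR0 (exs (alln (#0 ∈ 0 <--> shifts A)))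
| ax_recursion (th : form) :
    arithmetical th -> ATR0 (alls (well_order 0 --> exs (hierarchy th))).

(** ** The rationals

    ((m,n),k) codes the rational number (m - n)/(k + 1).  [qle] compares codes
    by value; the set Q consists of the codes that are least (as natural
    numbers) among the codes of the same rational. *)

Definition qle (s t : term) : form :=
  exn (exn (exn (exn (exn (exn (
    let m := #5 in let n := #4 in let k := #3 in
    let m' := #2 in let n' := #1 in let k' := #0 in
    tshift 6 s == tpair (tpair m n) k /\ tshift 6 t == tpair (tpair m' n') k' /\
    m * (k' + 1) + n' * (k + 1) <= m' * (k + 1) + n * (k' + 1)))))))%form.

Definition isQ (t : term) : form :=
  ( qle t t /\
    alln (let u := #0 in let t := tshift 1 t in
      u < t --> ~ (qle u t /\ qle t u)) )%form.

(** ** Partial orders (P, R) *)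

Definition partial_order (P R : nat) : form :=
  ( alln (let z := #0 in
      z ∈ R --> exn (exn (let z := #2 in let x := #1 in let y := #0 in
        z == tpair x y /\ x ∈ P /\ y ∈ P)))
    /\ alln (let x := #0 in x ∈ P --> rel R x x)
    /\ alln (alln (let x := #1 in let y := #0 in
      rel R x y /\ rel R y x --> x == y))
    /\ alln (alln (alln (let x := #2 in let y := #1 in let z := #0 in
      rel R x y /\ rel R y z --> rel R x z))) )%form.

Definition scattered (P R : nat) : form :=
  ( ~ exs (let f := O in let P := S P in let R := S R in
      func isQ (fun y => y ∈ P) f /\
      alln (alln (alln (alln (
        let a := #3 in let b := #2 in let x := #1 in let y := #0 in
        tpair a x ∈ f /\ tpair b y ∈ f --> (qle a b <--> rel R x y))))))
  )%form.

Definition antichain (P R D : nat) : form :=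
  ( alln (#0 ∈ D --> #0 ∈ P) /\
    alln (alln (let x := #1 in let y := #0 in
      x ∈ D /\ y ∈ D /\ ~ x == y --> ~ rel R x y /\ ~ rel R y x)) )%form.

Definition infinite (D : nat) : form :=
  alln (exn (let k := #1 in let i := #0 in k < i /\ i ∈ D))%form.

Definition no_infinite_antichain (P R : nat) : form :=
  ( ~ exs (let D := O in antichain (S P) (S R) D /\ infinite D) )%form.

Definition initial_interval (P R I : nat) : form :=
  ( alln (#0 ∈ I --> #0 ∈ P) /\
    alln (alln (let x := #1 in let y := #0 in
      rel R x y /\ y ∈ I --> x ∈ I)) )%form.

(** A set [J] codes the sequence of the sets J_n = {x : (x,n) ∈ J}. *)
Definition countably_many_initial_intervals (P R : nat) : form :=
  exs (alls (let J := 1%nat in let I := O in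
    initial_interval (2 + P) (2 + R) I -->
    exn (alln (let n := #1 in let x := #0 in
      x ∈ I <--> tpair x n ∈ J))))%form.

(* Main.v *)
(** By completeness it suffices to argue inside an arbitrary model of ATR_0.

    Let [P] be scattered without infinite antichains.  The finite attempts to
    embed the rationals, taken in the order of their codes, into [P] form a
    tree without paths, so its Kleene-Brouwer order is a well-order and
    arithmetical recursion along the tree is available.  An attempt [s] of
    length [n] leaves a "gap" of admissible values for every [m >= n].  The
    recursion declares gaps small: the gap of [n] is small if every choice of a
    value [x] for [n] leaves a small gap on one side of [x], and any other gap
    is small if it is so after some choice.  By induction on the tree every
    attempt has a small gap; the only gap of the empty attempt is [P].

    Fix an initial interval [I].  In a small gap, [I] either follows the rule
    "[x] is in [I] unless the half above [x] is small", which determines [I]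
    there, or some [x] breaks the rule; then, within the gap, [I] consists of
    its trace on a small half, its trace on the points incomparable to [x] and,
    if [x] is in [I], the points below [x].  Passing to incomparable points
    terminates since antichains are finite.  Hence [I] is a finite union of
    principal initial intervals and of sets from a fixed sequence. *)

From Stdlib Require Import List Arith Lia Cantor Ring.
From Stdlib Require Import Classical ClassicalEpsilon FunctionalExtensionality
  PropExtensionality ProofIrrelevance.
Require Import Defs.

(** * Substitution *)

(** The numbers of the model may be nonstandard, and induction, along [<] or along the tree, is
    available only for sets. This shapes the argument. That a gap has countably many initial
    intervals is a statement with set quantifiers, useless as a recursion clause or as an induction
    predicate; smallness is an arithmetical substitute. For the same reason the sequence [gen_set]
    is built before any interval is chosen: with [I] fixed, the existence of a code [e] that covers
    a part of [I] is arithmetical in [I], so that induction on the tree applies to it. The descent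
    through incomparable points is no induction on the size of antichains either; a failure would be
    prolonged by dependent choice to an infinite antichain.

    The rule compared with [I] has the following origin. A point [x] of [I] leaves only the half
    above it to be described, since one principal interval takes care of the points below; a point
    outside [I] leaves only the half below it. The rule is set up so that breaking it makes the
    remaining half a small one. *)

Lemma tsubst_comp sg sg' t :
  tsubst sg (tsubst sg' t) = tsubst (fun k => tsubst sg (sg' k)) t.
Proof. induction t; cbn; congruence. Qed.

Lemma tsubst_id t : tsubst tvar t = t.
Proof. induction t; cbn; congruence. Qed.

Lemma scons_eta {A : Type} (f : nat -> A) : scons (f 0) (fun k => f (S k)) = f.
Proof. extensionality k; destruct k; reflexivity. Qed.

Lemma scons_map {A B : Type} (f : A -> B) a g :
  (fun k => f (scons a g k)) = scons (f a) (fun k => f (g k)).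
Proof. extensionality k; destruct k; reflexivity. Qed.

Lemma upn_id : upn tvar = tvar.
Proof. exact (scons_eta tvar). Qed.

Lemma ups_id : ups (fun X => X) = (fun X => X).
Proof. exact (scons_eta (fun X => X)). Qed.

Lemma upn_comp sg sg' :
  (fun k => tsubst (upn sg) (upn sg' k)) = upn (fun k => tsubst sg (sg' k)).
Proof.
  extensionality k; destruct k; [reflexivity|]. cbn. unfold tshift.
  now rewrite !tsubst_comp.
Qed.

Lemma ups_comp rh rh' :
  (fun k => ups rh (ups rh' k)) = ups (fun k => rh (rh' k)).
Proof. extensionality k; destruct k; reflexivity. Qed.

Lemma subst_comp A : forall sg rh sg' rh',
  subst sg rh (subst sg' rh' A)
  = subst (fun k => tsubst sg (sg' k)) (fun k => rh (rh' k)) A.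
Proof.
  induction A; intros; cbn; rewrite ?tsubst_comp; try reflexivity.
  - now rewrite IHA1, IHA2.
  - now rewrite IHA, upn_comp.
  - now rewrite IHA, ups_comp.
Qed.

Lemma subst_id A : subst tvar (fun X => X) A = A.
Proof.
  induction A; cbn; rewrite ?upn_id, ?ups_id, ?tsubst_id; congruence.
Qed.

Lemma instn_upn t sg rh A : instn t (subst (upn sg) rh A) = subst (scons t sg) rh A.
Proof.
  unfold instn. rewrite subst_comp. f_equal.
  extensionality k; destruct k; [reflexivity|]. cbn. unfold tshift.
  rewrite tsubst_comp. apply tsubst_id.
Qed.

Lemma insts_ups X sg rh A : insts X (subst sg (ups rh) A) = subst sg (scons X rh) A.
Proof.
  unfold insts. rewrite subst_comp. f_equal.
  - extensionality k. apply tsubst_id.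
  - extensionality k; destruct k; reflexivity.
Qed.

Lemma tsubst_finite t : exists N, forall sg sg',
  (forall k, k < N -> sg k = sg' k) -> tsubst sg t = tsubst sg' t.
Proof.
  induction t as [n| | |s [N1 H1] t [N2 H2]|s [N1 H1] t [N2 H2]].
  - exists (S n). intros sg sg' H. apply H. lia.
  - exists 0. reflexivity.
  - exists 0. reflexivity.
  - exists (N1 + N2). intros. cbn.
    rewrite (H1 sg sg'), (H2 sg sg'); auto; intros; apply H; lia.
  - exists (N1 + N2). intros. cbn.
    rewrite (H1 sg sg'), (H2 sg sg'); auto; intros; apply H; lia.
Qed.

(** A bound on the free variables, expressed through substitution instead of occurrences. One bound
    serves both sorts. *)
Definition supported_by (N : nat) (A : form) : Prop :=
  forall sg sg' rh rh',
    (forall k, k < N -> sg k = sg' k) -> (forall k, k < N -> rh k = rh' k) ->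
    subst sg rh A = subst sg' rh' A.

Lemma supported_by_le N M A : N <= M -> supported_by N A -> supported_by M A.
Proof. intros le H sg sg' rh rh' H1 H2. apply H; intros; [apply H1|apply H2]; lia. Qed.

Lemma supported A : exists N, supported_by N A.
Proof.
  unfold supported_by.
  induction A as [s t|s t|t X| |A [N1 H1] B [N2 H2]|A [N H]|A [N H]].
  - destruct (tsubst_finite s) as [N1 H1], (tsubst_finite t) as [N2 H2].
    exists (N1 + N2). intros. cbn.
    rewrite (H1 sg sg'), (H2 sg sg'); auto; intros; apply H; lia.
  - destruct (tsubst_finite s) as [N1 H1], (tsubst_finite t) as [N2 H2].
    exists (N1 + N2). intros. cbn.
    rewrite (H1 sg sg'), (H2 sg sg'); auto; intros; apply H; lia.
  - destruct (tsubst_finite t) as [N1 H1]. exists (N1 + S X). intros. cbn.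
    rewrite (H1 sg sg'), (H0 X); auto; try lia; intros; apply H; lia.
  - exists 0. reflexivity.
  - exists (N1 + N2). intros. cbn.
    rewrite (H1 sg sg' rh rh'), (H2 sg sg' rh rh'); auto; intros;
      try (apply H; lia); apply H0; lia.
  - exists N. intros. cbn. f_equal. apply H; auto.
    intros [|k] Hk; [reflexivity|]. cbn. rewrite H0; [reflexivity|lia].
  - exists N. intros. cbn. f_equal. apply H; auto.
    intros [|k] Hk; [reflexivity|]. cbn. rewrite H1; [reflexivity|lia].
Qed.

Lemma supported_list G : exists N, forall A, In A G -> supported_by N A.
Proof.
  induction G as [|A G [N IH]].
  - exists 0. intros A [].
  - destruct (supported A) as [M HM]. exists (N + M).
    intros B [<-|HB]; [apply (supported_by_le M); auto; lia|].
    apply (supported_by_le N); auto; lia.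
Qed.

(** * Derivations *)

Section Derivations.
Variable T : form -> Prop.

Lemma weakening G A : derivable T G A -> forall G', incl G G' -> derivable T G' A.
Proof.
  induction 1; intros G' Hi.
  - now apply d_ax.
  - apply d_hyp; auto.
  - apply d_impI, IHderivable. intros C [<-|HC]; [now left|right; auto].
  - eapply d_impE; eauto.
  - apply d_raa, IHderivable. intros C [<-|HC]; [now left|right; auto].
  - apply d_allnI, IHderivable. now apply incl_map.
  - apply d_allnE; auto.
  - apply d_allsI, IHderivable. now apply incl_map.
  - apply d_allsE; auto.
  - apply d_eqI.
  - eapply d_eqE; eauto.
Qed.

Lemma cut G A B : derivable T G A -> derivable T (A :: G) B -> derivable T G B.
Proof. intros H1 H2. eapply d_impE; [apply d_impI, H2|exact H1]. Qed.

Lemma explosion G A : derivable T G fbot -> derivable T G A.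
Proof. intros H. apply d_raa. eapply weakening; [exact H|]. now right. Qed.

Lemma derivable_instn_list ts A :
  derivable T nil (Nat.iter (length ts) alln A) ->
  derivable T nil (subst (fold_right scons tvar ts) (fun X => X) A).
Proof.
  revert A; induction ts as [|t ts IH]; intros A H; cbn in *.
  - now rewrite subst_id.
  - rewrite <- instn_upn. apply d_allnE.
    apply (IH (alln A)). rewrite <- Nat.iter_succ_r. exact H.
Qed.

Lemma derivable_insts_list Xs A :
  derivable T nil (Nat.iter (length Xs) alls A) ->
  derivable T nil (subst tvar (fold_right scons (fun X => X) Xs) A).
Proof.
  revert A; induction Xs as [|X Xs IH]; intros A H; cbn in *.
  - now rewrite subst_id.
  - rewrite <- insts_ups. apply d_allsE.
    apply (IH (alls A)). rewrite <- Nat.iter_succ_r. exact H.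
Qed.

Lemma fold_scons_map {A : Type} (f g : nat -> A) k :
  forall m j, k < m -> fold_right scons g (map f (seq j m)) k = f (j + k).
Proof.
  induction k as [|k IH]; intros [|m] j H; try lia; cbn.
  - f_equal; lia.
  - rewrite IH by lia. f_equal; lia.
Qed.

(** Induction on the derivation would fail at the axioms, as [T] need not be closed under
    substitution. Without assumptions all free variables can be generalised, so the formula is
    closed and then instantiated, first for numbers and then for sets. Only finitely many variables
    matter, hence lists of instances suffice. *)
Lemma provable_subst A sg rh :
  derivable T nil A -> derivable T nil (subst sg rh A).
Proof.
  intros H. destruct (supported A) as [N HN].
  assert (H1 : derivable T nil (subst sg (fun X => X) A)).
  { rewrite (HN sg (fold_right scons tvar (map sg (seq 0 N)))
               (fun X => X) (fun X => X)); auto.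
    - apply derivable_instn_list. rewrite length_map, length_seq.
      generalize N; intros n. induction n; cbn; auto. apply d_allnI. exact IHn.
    - intros k Hk. now rewrite fold_scons_map. }
  destruct (supported (subst sg (fun X => X) A)) as [M HM].
  replace (subst sg rh A) with (subst tvar rh (subst sg (fun X => X) A)).
  - rewrite (HM tvar tvar rh (fold_right scons (fun X => X) (map rh (seq 0 M)))); auto.
    + apply derivable_insts_list. rewrite length_map, length_seq.
      generalize M; intros n. induction n; cbn; auto. apply d_allsI. exact IHn.
    + intros k Hk. now rewrite fold_scons_map.
  - rewrite subst_comp. f_equal. extensionality k. apply tsubst_id.
Qed.

Definition imps (G : list form) (A : form) : form :=
  fold_left (fun B C => fimp C B) G A.

Lemma subst_imps sg rh G : forall A,
  subst sg rh (imps G A) = imps (map (subst sg rh) G) (subst sg rh A).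
Proof. induction G as [|B G IH]; intros A; [reflexivity|]. exact (IH (fimp B A)). Qed.

Lemma imps_intro G : forall A, derivable T G A -> derivable T nil (imps G A).
Proof.
  induction G as [|B G IH]; intros A H; cbn; auto.
  apply IH, d_impI, H.
Qed.

Lemma imps_elim G : forall A, derivable T nil (imps G A) -> derivable T G A.
Proof.
  induction G as [|B G IH]; intros A H; cbn in *; auto.
  apply IH in H. eapply d_impE.
  - eapply weakening; [exact H|]. now right.
  - apply d_hyp. now left.
Qed.

(** The assumptions are moved into the formula, where [provable_subst] reaches them. *)
Lemma derivable_subst G A sg rh :
  derivable T G A -> derivable T (map (subst sg rh) G) (subst sg rh A).
Proof.
  intros H. apply imps_elim. rewrite <- subst_imps.
  apply provable_subst. now apply imps_intro.
Qed.

(** The eigenvariable form of generalisation. The Henkin construction needs it, because there the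
    witness is a variable in the same unshifted context. *)
Lemma fresh_allnI G A x :
  (forall B, In B (A :: G) -> supported_by x B) ->
  derivable T G (instn (tvar x) A) -> derivable T G (alln A).
Proof.
  intros Hx H. apply d_allnI.
  (* This renaming undoes the instantiation at [x], and on formulas without [x] it agrees with
     [shiftn]. *)
  apply (derivable_subst _ _ (fun k => if Nat.eqb k x then tvar 0 else tvar (S k))
           (fun X => X)) in H.
  assert (E : subst (fun k => if Nat.eqb k x then tvar 0 else tvar (S k))
           (fun X => X) (instn (tvar x) A) = A).
  { unfold instn. rewrite subst_comp. rewrite <- (subst_id A) at 2.
    apply (Hx A (or_introl eq_refl)); auto. intros [|k] Hk; cbn.
    - now rewrite Nat.eqb_refl.
    - destruct (Nat.eqb_spec k x); [lia|reflexivity]. }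
  rewrite E in H. erewrite map_ext_in; [exact H|].
  intros B HB. apply (Hx B (or_intror HB)); auto.
  intros k Hk. destruct (Nat.eqb_spec k x); [lia|reflexivity].
Qed.

Lemma fresh_allsI G A x :
  (forall B, In B (A :: G) -> supported_by x B) ->
  derivable T G (insts x A) -> derivable T G (alls A).
Proof.
  intros Hx H. apply d_allsI.
  apply (derivable_subst _ _ tvar (fun k => if Nat.eqb k x then 0 else S k)) in H.
  assert (E : subst tvar (fun k => if Nat.eqb k x then 0 else S k) (insts x A) = A).
  { unfold insts. rewrite subst_comp. rewrite <- (subst_id A) at 2.
    apply (Hx A (or_introl eq_refl)); auto. intros [|k] Hk; cbn.
    - now rewrite Nat.eqb_refl.
    - destruct (Nat.eqb_spec k x); [lia|reflexivity]. }
  rewrite E in H. erewrite map_ext_in; [exact H|].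
  intros B HB. apply (Hx B (or_intror HB)); auto.
  intros k Hk. destruct (Nat.eqb_spec k x); [lia|reflexivity].
Qed.

End Derivations.

(** * Completeness *)

Fixpoint term_code (t : term) : nat :=
  match t with
  | tvar n => to_nat (0, n)
  | tzero => to_nat (1, 0)
  | tone => to_nat (2, 0)
  | tadd s t => to_nat (3, to_nat (term_code s, term_code t))
  | tmul s t => to_nat (4, to_nat (term_code s, term_code t))
  end.

Fixpoint form_code (A : form) : nat :=
  match A with
  | feq s t => to_nat (0, to_nat (term_code s, term_code t))
  | flt s t => to_nat (1, to_nat (term_code s, term_code t))
  | fmem t X => to_nat (2, to_nat (term_code t, X))
  | fbot => to_nat (3, 0)
  | fimp A B => to_nat (4, to_nat (form_code A, form_code B))
  | alln A => to_nat (5, form_code A)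
  | alls A => to_nat (6, form_code A)
  end.

Ltac invert_code :=
  repeat match goal with
  | H : to_nat _ = to_nat _ |- _ => apply to_nat_inj in H
  | H : (_, _) = (_, _) |- _ => apply pair_equal_spec in H as [? ?]
  end; try discriminate.

Lemma term_code_inj s : forall t, term_code s = term_code t -> s = t.
Proof.
  induction s; intros [] H; cbn -[to_nat] in H; invert_code; f_equal; auto.
Qed.

Lemma form_code_inj A : forall B, form_code A = form_code B -> A = B.
Proof.
  induction A; intros [] H; cbn -[to_nat] in H; invert_code; f_equal;
    auto using term_code_inj.
Qed.

(** Numbers that code no formula yield an arbitrary one; only surjectivity matters. *)
Definition nth_form (n : nat) : form := epsilon (inhabits fbot) (fun A => form_code A = n).

Lemma nth_form_surj A : nth_form (form_code A) = A.
Proof.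
  apply form_code_inj. unfold nth_form.
  apply (epsilon_spec (inhabits fbot) (fun B => form_code B = form_code A)).
  now exists A.
Qed.

(** * Henkin extensions of a consistent list *)

Section Henkin.
Variable T : form -> Prop.

Definition consistent (G : list form) : Prop := ~ derivable T G fbot.

(** Existential quantifiers are defined from universal ones, so the formulas that demand a witness
    are the negated universal ones. *)
Definition witnessed (G : list form) (A : form) : Prop :=
  (forall B, A = fneg (alln B) -> exists x, In (fneg (instn (tvar x) B)) G) /\
  (forall B, A = fneg (alls B) -> exists x, In (fneg (insts x B)) G).

(** Every stage is a finite list, so some variable is fresh and can serve as the witness; no new
    constants are required. If adding the witness were inconsistent, generalising over the fresh
    variable would refute [A]. *)
Lemma henkin_step G A : consistent G ->
  exists G', incl G G' /\ consistent G' /\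
    ((In A G' /\ witnessed G' A) \/ ~ consistent (A :: G')).
Proof.
  intros HG. destruct (classic (consistent (A :: G))) as [HA|HA].
  2:{ exists G. split; [apply incl_refl|]. auto. }
  destruct (classic (exists B, A = fneg (alln B))) as [[B ->]|nB].
  { destruct (supported_list (B :: fneg (alln B) :: G)) as [x Hx].
    exists (fneg (instn (tvar x) B) :: fneg (alln B) :: G).
    split; [now do 2 apply incl_tl; apply incl_refl|]. split.
    - intros H. apply d_raa in H.
      apply HA. eapply d_impE; [apply d_hyp; now left|].
      eapply fresh_allnI; [|exact H]. intros C HC. apply Hx, HC.
    - left. split; [right; now left|]. split.
      + intros B' [= <-]. exists x. now left.
      + intros B' [=]. }
  destruct (classic (exists B, A = fneg (alls B))) as [[B ->]|nB'].
  { destruct (supported_list (B :: fneg (alls B) :: G)) as [x Hx].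
    exists (fneg (insts x B) :: fneg (alls B) :: G).
    split; [now do 2 apply incl_tl; apply incl_refl|]. split.
    - intros H. apply d_raa in H.
      apply HA. eapply d_impE; [apply d_hyp; now left|].
      eapply fresh_allsI; [|exact H]. intros C HC. apply Hx, HC.
    - left. split; [right; now left|]. split.
      + intros B' [=].
      + intros B' [= <-]. exists x. now left. }
  exists (A :: G). split; [now apply incl_tl, incl_refl|]. split; [exact HA|].
  left. split; [now left|]. split; intros B ->; exfalso; eauto.
Qed.

Variable G0 : list form.
Hypothesis G0_consistent : consistent G0.

Definition henkin_next (n : nat) (G : list form) : list form :=
  epsilon (inhabits G) (fun G' => incl G G' /\ consistent G' /\
    ((In (nth_form n) G' /\ witnessed G' (nth_form n))
     \/ ~ consistent (nth_form n :: G'))).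

Fixpoint henkin (n : nat) : list form :=
  match n with O => G0 | S n => henkin_next n (henkin n) end.

Lemma henkin_next_spec n G : consistent G ->
  incl G (henkin_next n G) /\ consistent (henkin_next n G) /\
    ((In (nth_form n) (henkin_next n G) /\ witnessed (henkin_next n G) (nth_form n))
     \/ ~ consistent (nth_form n :: henkin_next n G)).
Proof.
  intros HG. unfold henkin_next.
  apply (epsilon_spec (inhabits G) (fun G' => incl G G' /\ consistent G' /\
    ((In (nth_form n) G' /\ witnessed G' (nth_form n))
     \/ ~ consistent (nth_form n :: G')))).
  now apply henkin_step.
Qed.

Lemma henkin_consistent n : consistent (henkin n).
Proof. induction n; cbn; auto. now apply henkin_next_spec. Qed.

Lemma henkin_mono m n : m <= n -> incl (henkin m) (henkin n).
Proof.
  induction 1; [apply incl_refl|]. cbn. eapply incl_tran; [exact IHle|].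
  apply henkin_next_spec, henkin_consistent.
Qed.

Definition holds (A : form) : Prop := exists n, derivable T (henkin n) A.

Lemma holds_derivable A : (exists G, (forall B, In B G -> holds B) /\ derivable T G A) ->
  holds A.
Proof.
  intros (G & HG & H). revert A H. induction G as [|B G IH]; intros A H.
  - exists 0. eapply weakening; [exact H|]. intros C [].
  - destruct (IH (fun C HC => HG C (or_intror HC)) (fimp B A)) as [n Hn].
    { now apply d_impI. }
    destruct (HG B (or_introl eq_refl)) as [m Hm].
    exists (Nat.max n m). eapply d_impE.
    + eapply weakening; [exact Hn|]. apply henkin_mono; lia.
    + eapply weakening; [exact Hm|]. apply henkin_mono; lia.
Qed.

Lemma holds_mp A B : holds (fimp A B) -> holds A -> holds B.
Proof.
  intros H1 H2. apply holds_derivable. exists (fimp A B :: A :: nil). split.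
  - intros C [<-|[<-|[]]]; auto.
  - eapply d_impE; apply d_hyp; cbn; auto.
Qed.

Lemma holds_provable A : derivable T nil A -> holds A.
Proof. intros H. apply holds_derivable. exists nil. split; auto. intros B []. Qed.

Lemma holds_bot : ~ holds fbot.
Proof. intros [n H]. exact (henkin_consistent n H). Qed.

(** A formula is decided at the stage given by its code. Had it been rejected there although some
    stage derives it, a common later stage would be inconsistent. *)
Lemma holds_stage A : holds A ->
  In A (henkin (S (form_code A))) /\ witnessed (henkin (S (form_code A))) A.
Proof.
  intros [m Hm]. cbn.
  destruct (henkin_next_spec (form_code A) _ (henkin_consistent (form_code A)))
    as (_ & _ & [H|H]); rewrite nth_form_surj in *; auto.
  exfalso. apply H. intros H'. set (n := form_code A) in *.
  apply (henkin_consistent (m + S n)). eapply cut.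
  - eapply weakening; [exact Hm|]. apply henkin_mono; lia.
  - eapply weakening; [exact H'|]. intros C [<-|HC]; [now left|right].
    revert HC. apply (henkin_mono (S n)). lia.
Qed.

Lemma holds_neg A : holds (fneg A) <-> ~ holds A.
Proof.
  split.
  - intros H1 H2. exact (holds_bot (holds_mp _ _ H1 H2)).
  - intros H. destruct (henkin_next_spec (form_code A) _ (henkin_consistent (form_code A)))
      as (_ & _ & [[H1 _]|H1]); rewrite nth_form_surj in *.
    + exfalso. apply H. exists (S (form_code A)). now apply d_hyp.
    + exists (S (form_code A)). apply d_impI. now apply NNPP.
Qed.

Lemma holds_imp A B : holds (fimp A B) <-> (holds A -> holds B).
Proof.
  split; [apply holds_mp|]. intros H. destruct (classic (holds A)) as [HA|HA].
  - apply holds_derivable. exists (B :: nil). split.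
    + intros C [<-|[]]; auto.
    + apply d_impI, d_hyp. cbn; auto.
  - apply holds_neg in HA. apply holds_derivable. exists (fneg A :: nil). split.
    + intros C [<-|[]]; auto.
    + apply d_impI, explosion. apply (d_impE _ _ A); apply d_hyp; cbn; auto.
Qed.

Lemma holds_alln A : holds (alln A) <-> forall t, holds (instn t A).
Proof.
  split.
  - intros H t. apply holds_derivable. exists (alln A :: nil). split.
    + intros C [<-|[]]; auto.
    + apply d_allnE, d_hyp. now left.
  - intros H. apply NNPP. intros H'. apply holds_neg, holds_stage in H'.
    destruct H' as (_ & H' & _). destruct (H' A eq_refl) as [x Hx].
    apply (proj1 (holds_neg (instn (tvar x) A))); [|apply H].
    exact (ex_intro _ _ (d_hyp _ _ _ Hx)).
Qed.

Lemma holds_alls A : holds (alls A) <-> forall X, holds (insts X A).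
Proof.
  split.
  - intros H X. apply holds_derivable. exists (alls A :: nil). split.
    + intros C [<-|[]]; auto.
    + apply d_allsE, d_hyp. now left.
  - intros H. apply NNPP. intros H'. apply holds_neg, holds_stage in H'.
    destruct H' as (_ & _ & H'). destruct (H' A eq_refl) as [x Hx].
    apply (proj1 (holds_neg (insts x A))); [|apply H].
    exact (ex_intro _ _ (d_hyp _ _ _ Hx)).
Qed.

End Henkin.

(** * Models *)

(* Only models with a distinguished assignment that names every number and
   every set are considered; these suffice for completeness, and they make
   every parameter of a formula available as a variable. *)

Record structure : Type := {
  num :> Type;
  nzero : num;
  nunity : num;
  nadd : num -> num -> num;
  nmul : num -> num -> num;
  nlt : num -> num -> Prop;
  n_env : nat -> num;
  s_env : nat -> num -> Prop
}.

Lemma all_iff {A : Type} (P Q : A -> Prop) :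
  (forall x, P x <-> Q x) -> (forall x, P x) <-> (forall x, Q x).
Proof. intros E; split; intros K x; apply E, K. Qed.

Lemma ex_iff {A : Type} (P Q : A -> Prop) :
  (forall x, P x <-> Q x) -> (exists x, P x) <-> (exists x, Q x).
Proof. intros E; split; intros [x K]; exists x; apply E, K. Qed.

Section Semantics.
Variable M : structure.

Fixpoint eval (e : nat -> M) (t : term) : M :=
  match t with
  | tvar n => e n
  | tzero => nzero M
  | tone => nunity M
  | tadd s t => nadd M (eval e s) (eval e t)
  | tmul s t => nmul M (eval e s) (eval e t)
  end.

(** Set quantifiers range over the named sets only, as in Henkin semantics. Sets are predicates,
    hence extensional by the extensionality axioms. *)
Definition isset (X : M -> Prop) : Prop := exists i, X = s_env M i.

Fixpoint sat (e : nat -> M) (r : nat -> M -> Prop) (A : form) : Prop :=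
  match A with
  | feq s t => eval e s = eval e t
  | flt s t => nlt M (eval e s) (eval e t)
  | fmem t X => r X (eval e t)
  | fbot => False
  | fimp A B => sat e r A -> sat e r B
  | alln A => forall x, sat (scons x e) r A
  | alls A => forall X, isset X -> sat e (scons X r) A
  end.

Definition models (T : form -> Prop) : Prop :=
  forall A e r, T A -> (forall i, isset (r i)) -> sat e r A.

Definition named : Prop := forall c : M, exists t, eval (n_env M) t = c.

Lemma eval_subst e sg t : eval e (tsubst sg t) = eval (fun k => eval e (sg k)) t.
Proof. induction t; cbn; congruence. Qed.

Lemma sat_subst A : forall e r sg rh,
  sat e r (subst sg rh A) <-> sat (fun k => eval e (sg k)) (fun k => r (rh k)) A.
Proof.
  induction A; intros; cbn; rewrite ?eval_subst; try reflexivity.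
  - now rewrite IHA1, IHA2.
  - apply all_iff; intros x. rewrite IHA.
    replace (fun k => eval (scons x e) (upn sg k))
      with (scons x (fun k => eval e (sg k))); [reflexivity|].
    extensionality k; destruct k; [reflexivity|]. cbn. unfold tshift.
    now rewrite eval_subst.
  - apply all_iff; intros X. rewrite IHA.
    replace (fun k => scons X r (ups rh k)) with (scons X (fun k => r (rh k)));
      [reflexivity|].
    extensionality k; destruct k; reflexivity.
Qed.

End Semantics.

(** * The term model *)

Section TermModel.
Variable T : form -> Prop.
Variable G0 : list form.
Hypothesis G0_consistent : consistent T G0.

Let H := holds T G0.

Definition term_eq (s t : term) : Prop := holds T G0 (feq s t).

Lemma term_eq_refl t : term_eq t t.
Proof. apply holds_provable; auto. apply d_eqI. Qed.

Lemma term_eq_rewrite A s t : term_eq s t -> H (instn s A) -> H (instn t A).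
Proof.
  intros H1 H2. apply holds_derivable; auto.
  exists (feq s t :: instn s A :: nil). split.
  - intros B [<-|[<-|[]]]; auto.
  - apply (d_eqE _ _ _ s); apply d_hyp; cbn; auto.
Qed.

Lemma instn_tshift t u : tsubst (scons u tvar) (tshift 1 t) = t.
Proof. unfold tshift. rewrite tsubst_comp. apply tsubst_id. Qed.

Lemma term_eq_sym s t : term_eq s t -> term_eq t s.
Proof.
  intros E. generalize (term_eq_rewrite (feq (tvar 0) (tshift 1 s)) s t E).
  unfold instn; cbn; rewrite !instn_tshift. intros K. apply K, term_eq_refl.
Qed.

Lemma term_eq_trans s t u : term_eq s t -> term_eq t u -> term_eq s u.
Proof.
  intros E1 E2. generalize (term_eq_rewrite (feq (tshift 1 s) (tvar 0)) t u E2).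
  unfold instn; cbn; rewrite !instn_tshift. intros K. apply K, E1.
Qed.

(** [feq] is interpreted by Rocq's equality, so provably equal terms have to be identified.
    [epsilon] picks the same representative for all of them, because their predicates [term_eq t]
    are equal. *)
Definition class (t : term) : term := epsilon (inhabits t) (term_eq t).

Lemma class_spec t : term_eq t (class t).
Proof.
  apply (epsilon_spec (inhabits t) (term_eq t)). exists t. apply term_eq_refl.
Qed.

Lemma class_eq s t : class s = class t <-> term_eq s t.
Proof.
  split.
  - intros E. apply term_eq_trans with (class t); [|apply term_eq_sym, class_spec].
    rewrite <- E. apply class_spec.
  - intros E. unfold class. replace (term_eq s) with (term_eq t).
    + f_equal. apply proof_irrelevance.
    + extensionality u. apply propositional_extensionality; split; intros K.
      * eapply term_eq_trans; eauto.
      * eapply term_eq_trans; [apply term_eq_sym|]; eauto.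
Qed.

Lemma class_idem t : class (class t) = class t.
Proof. apply class_eq, term_eq_sym, class_spec. Qed.

Definition cls (t : term) : {t : term | class t = t} := exist _ (class t) (class_idem t).

Lemma cls_eq s t : cls s = cls t <-> term_eq s t.
Proof.
  rewrite <- class_eq. split; intros E.
  - exact (f_equal (@proj1_sig _ _) E).
  - apply eq_sig_hprop; [|exact E]. intros; apply proof_irrelevance.
Qed.

Lemma cls_surj c : exists t, c = cls t.
Proof.
  destruct c as [t Ht]. exists t. apply eq_sig_hprop; [|easy].
  intros; apply proof_irrelevance.
Qed.

Lemma cls_proj t : cls (proj1_sig (cls t)) = cls t.
Proof. apply cls_eq, term_eq_sym, class_spec. Qed.

Lemma term_eq_congr (f : term -> term -> term) :
  (forall sg s t, tsubst sg (f s t) = f (tsubst sg s) (tsubst sg t)) ->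
  forall s s' t t', term_eq s s' -> term_eq t t' -> term_eq (f s t) (f s' t').
Proof.
  intros Hf s s' t t' E1 E2. apply term_eq_trans with (f s' t).
  - generalize (term_eq_rewrite
      (feq (f (tshift 1 s) (tshift 1 t)) (f (tvar 0) (tshift 1 t))) s s' E1).
    unfold instn; cbn; rewrite !Hf, !instn_tshift. intros K. apply K, term_eq_refl.
  - generalize (term_eq_rewrite
      (feq (f (tshift 1 s') (tshift 1 t)) (f (tshift 1 s') (tvar 0))) t t' E2).
    unfold instn; cbn; rewrite !Hf, !instn_tshift. intros K. apply K, term_eq_refl.
Qed.

Definition term_structure : structure := {|
  num := {t : term | class t = t};
  nzero := cls tzero;
  nunity := cls tone;
  nadd c d := cls (tadd (proj1_sig c) (proj1_sig d));
  nmul c d := cls (tmul (proj1_sig c) (proj1_sig d));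
  nlt c d := H (flt (proj1_sig c) (proj1_sig d));
  n_env k := cls (tvar k);
  s_env X c := H (fmem (proj1_sig c) X)
|}.

Lemma eval_cls sg t : eval term_structure (fun k => cls (sg k)) t = cls (tsubst sg t).
Proof.
  induction t; cbn; auto; rewrite ?IHt1, ?IHt2; apply cls_eq.
  - apply (term_eq_congr tadd); auto; apply cls_eq, cls_proj.
  - apply (term_eq_congr tmul); auto; apply cls_eq, cls_proj.
Qed.

Lemma holds_flt s t : H (flt (proj1_sig (cls s)) (proj1_sig (cls t))) <-> H (flt s t).
Proof.
  assert (K : forall s s' t t', term_eq s s' -> term_eq t t' ->
            H (flt s t) -> H (flt s' t')).
  { clear s t. intros s s' t t' E1 E2 K.
    generalize (term_eq_rewrite (flt (tvar 0) (tshift 1 t)) s s' E1).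
    unfold instn; cbn; rewrite !instn_tshift. intros K1. specialize (K1 K).
    generalize (term_eq_rewrite (flt (tshift 1 s') (tvar 0)) t t' E2).
    unfold instn; cbn; rewrite !instn_tshift. intros K2. exact (K2 K1). }
  split; apply K; apply cls_eq; rewrite cls_proj; reflexivity.
Qed.

Lemma holds_fmem t X : H (fmem (proj1_sig (cls t)) X) <-> H (fmem t X).
Proof.
  split.
  - apply (term_eq_rewrite (fmem (tvar 0) X) (proj1_sig (cls t)) t), cls_eq, cls_proj.
  - apply (term_eq_rewrite (fmem (tvar 0) X) t (proj1_sig (cls t))), cls_eq.
    symmetry. apply cls_proj.
Qed.

(** All substitutions are treated at once, since the quantifier cases pass to extended ones. Every
    element is the class of a term and every set has an index, so the syntactic instances exhaust
    the range of the quantifiers. *)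
Lemma truth A : forall sg rh,
  sat term_structure (fun k => cls (sg k)) (fun k => s_env term_structure (rh k)) A
  <-> H (subst sg rh A).
Proof.
  induction A as [s t|s t|t X| |A IHA B IHB|A IH|A IH]; intros; cbn -[s_env].
  - rewrite !eval_cls. apply cls_eq.
  - rewrite !eval_cls. apply holds_flt.
  - rewrite eval_cls. apply holds_fmem.
  - split; [intros []|]. now apply holds_bot.
  - rewrite IHA, IHB. symmetry. now apply holds_imp.
  - unfold H. rewrite holds_alln by auto. split.
    + intros K t. rewrite instn_upn. apply IH. rewrite (scons_map cls). apply K.
    + intros K c. destruct (cls_surj c) as [t ->]. specialize (K t).
      rewrite instn_upn in K. apply IH in K. rewrite (scons_map cls) in K. exact K.
  - unfold H. rewrite holds_alls by auto. split.
    + intros K X. rewrite insts_ups. apply IH.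
      rewrite (scons_map (s_env term_structure)). apply K. now exists X.
    + intros K Z [X ->]. specialize (K X). rewrite insts_ups in K. apply IH in K.
      rewrite (scons_map (s_env term_structure)) in K. exact K.
Qed.

Lemma term_structure_models : models term_structure T.
Proof.
  intros A e r HA Hr.
  destruct (choice (fun k t => e k = cls t) (fun k => cls_surj (e k))) as [sg Hsg].
  destruct (choice (fun k X => r k = s_env term_structure X) Hr) as [rh Hrh].
  replace e with (fun k => cls (sg k)) by (extensionality k; auto).
  replace r with (fun k => s_env term_structure (rh k)) by (extensionality k; auto).
  apply truth. apply holds_provable; auto. now apply provable_subst, d_ax.
Qed.

Lemma term_structure_named : named term_structure.
Proof.
  intros c. destruct (cls_surj c) as [t ->]. exists t.
  cbn [n_env term_structure]. rewrite (eval_cls tvar). now rewrite tsubst_id.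
Qed.

End TermModel.

Theorem completeness (T : form -> Prop) (A : form) :
  (forall M, named M -> models M T -> sat M (n_env M) (s_env M) A) ->
  provable T A.
Proof.
  intros HA. apply d_raa. apply NNPP. intros HG.
  specialize (HA (term_structure T (fneg A :: nil) HG) (term_structure_named _ _ HG)
    (term_structure_models _ _ HG)).
  apply (truth _ _ HG A tvar (fun X => X)) in HA. rewrite subst_id in HA.
  apply (holds_neg _ _ HG A); auto. exists 0. apply d_hyp. now left.
Qed.

(** * Arithmetical definability *)

Section Connectives.
Variable M : structure.
Implicit Types (e : nat -> M) (r : nat -> M -> Prop).

Lemma sat_neg e r A P : (sat M e r A <-> P) -> (sat M e r (fneg A) <-> ~ P).
Proof. cbn; tauto. Qed.

Lemma sat_imp e r A B P Q : (sat M e r A <-> P) -> (sat M e r B <-> Q) ->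
  (sat M e r (fimp A B) <-> (P -> Q)).
Proof. cbn; tauto. Qed.

Lemma sat_and e r A B P Q : (sat M e r A <-> P) -> (sat M e r B <-> Q) ->
  (sat M e r (fand A B) <-> P /\ Q).
Proof. cbn; intros; destruct (classic P), (classic Q); tauto. Qed.

Lemma sat_or e r A B P Q : (sat M e r A <-> P) -> (sat M e r B <-> Q) ->
  (sat M e r (fdis A B) <-> P \/ Q).
Proof. cbn; intros; destruct (classic P), (classic Q); tauto. Qed.

Lemma sat_iff e r A B P Q : (sat M e r A <-> P) -> (sat M e r B <-> Q) ->
  (sat M e r (fiff A B) <-> (P <-> Q)).
Proof. cbn; intros; destruct (classic P), (classic Q); tauto. Qed.

Lemma sat_alln e r A (P : M -> Prop) : (forall x, sat M (scons x e) r A <-> P x) ->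
  (sat M e r (alln A) <-> forall x, P x).
Proof. exact (all_iff _ _). Qed.

Lemma sat_exn e r A (P : M -> Prop) : (forall x, sat M (scons x e) r A <-> P x) ->
  (sat M e r (exn A) <-> exists x, P x).
Proof.
  intros K. cbn. split.
  - intros H. apply NNPP. intros H'. apply H. intros x Hx. apply H'. exists x. now apply K.
  - intros [x Hx] H. apply (H x). now apply K.
Qed.

Lemma sat_alls e r A (P : (M -> Prop) -> Prop) :
  (forall X, isset M X -> (sat M e (scons X r) A <-> P X)) ->
  (sat M e r (alls A) <-> forall X, isset M X -> P X).
Proof. intros K. cbn. split; intros H X HX; apply (K X HX), H, HX. Qed.

Lemma sat_exs e r A (P : (M -> Prop) -> Prop) :
  (forall X, isset M X -> (sat M e (scons X r) A <-> P X)) ->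
  (sat M e r (exs A) <-> exists X, isset M X /\ P X).
Proof.
  intros K. cbn. split.
  - intros H. apply NNPP. intros H'. apply H. intros X HX Hs.
    apply H'. exists X. split; auto. now apply K.
  - intros (X & HX & Hp) H. apply (H X HX). now apply K.
Qed.

End Connectives.

Ltac sat_step :=
  lazymatch goal with
  | |- sat _ _ _ (fiff _ _) <-> _ => apply sat_iff
  | |- sat _ _ _ (fand _ _) <-> _ => apply sat_and
  | |- sat _ _ _ (exn _) <-> _ => apply sat_exn; intros ?
  | |- sat _ _ _ (exs _) <-> _ => apply sat_exs; intros ? ?
  | |- sat _ _ _ (fdis _ _) <-> _ => apply sat_or
  | |- sat _ _ _ (fneg _) <-> _ => apply sat_neg
  | |- sat _ _ _ (fimp _ _) <-> _ => apply sat_imp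
  | |- sat _ _ _ (alln _) <-> _ => apply sat_alln; intros ?
  | |- sat _ _ _ (alls _) <-> _ => apply sat_alls; intros ? ?
  | |- sat _ _ _ _ <-> _ => reflexivity
  end.

Lemma arithmetical_subst A : forall sg rh, arithmetical A -> arithmetical (subst sg rh A).
Proof. induction A; cbn; intros; firstorder. Qed.

Section Definability.
Variable M : structure.
Hypothesis M_named : named M.

Definition comb (k : nat) (e : nat -> M) (n : nat) : M :=
  if n <? k then e n else n_env M (n - k).

(** The first argument of a definable [p] is a set variable; it stands for the
    earlier stages in definitions by transfinite recursion.  Parameters need no
    mention, since [n_env] and [s_env] name everything. *)
Definition definable (k : nat) (p : (M -> Prop) -> (nat -> M) -> Prop) : Prop :=
  exists A, arithmetical A /\
    forall Z e, sat M (comb k e) (scons Z (s_env M)) A <-> p Z e.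

Definition tdefinable (k : nat) (f : (nat -> M) -> M) : Prop :=
  exists t, forall e, eval M (comb k e) t = f e.

Lemma comb_S k e x : scons x (comb k e) = comb (S k) (scons x e).
Proof. extensionality n. destruct n; reflexivity. Qed.

Lemma comb_1 e : comb 1 e = scons (e 0) (n_env M).
Proof.
  extensionality n. destruct n; [reflexivity|]. unfold comb; cbn. now rewrite Nat.sub_0_r.
Qed.

Lemma tdef_var k i : i < k -> tdefinable k (fun e => e i).
Proof.
  intros H. exists (tvar i). intros e. cbn. unfold comb.
  now rewrite (proj2 (Nat.ltb_lt i k) H).
Qed.

Lemma tdef_const k c : tdefinable k (fun _ => c).
Proof.
  destruct (M_named c) as [t Ht]. exists (tshift k t). intros e.
  unfold tshift. rewrite eval_subst, <- Ht. f_equal. extensionality n. cbn. unfold comb.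
  destruct (Nat.ltb_spec (k + n) k); [lia|]. f_equal; lia.
Qed.

Lemma tdef_add k f g : tdefinable k f -> tdefinable k g ->
  tdefinable k (fun e => nadd M (f e) (g e)).
Proof. intros [s Hs] [t Ht]. exists (tadd s t). intros e. cbn. now rewrite Hs, Ht. Qed.

Lemma tdef_mul k f g : tdefinable k f -> tdefinable k g ->
  tdefinable k (fun e => nmul M (f e) (g e)).
Proof. intros [s Hs] [t Ht]. exists (tmul s t). intros e. cbn. now rewrite Hs, Ht. Qed.

Lemma def_eq k f g : tdefinable k f -> tdefinable k g ->
  definable k (fun _ e => f e = g e).
Proof.
  intros [s Hs] [t Ht]. exists (feq s t). split; [exact I|]. intros Z e. cbn.
  now rewrite Hs, Ht.
Qed.

Lemma def_lt k f g : tdefinable k f -> tdefinable k g ->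
  definable k (fun _ e => nlt M (f e) (g e)).
Proof.
  intros [s Hs] [t Ht]. exists (flt s t). split; [exact I|]. intros Z e. cbn.
  now rewrite Hs, Ht.
Qed.

Lemma def_mem k X f : isset M X -> tdefinable k f -> definable k (fun _ e => X (f e)).
Proof.
  intros [i ->] [t Ht]. exists (fmem t (S i)). split; [exact I|]. intros Z e. cbn.
  now rewrite Ht.
Qed.

Lemma def_var_mem k f : tdefinable k f -> definable k (fun Z e => Z (f e)).
Proof.
  intros [t Ht]. exists (fmem t 0). split; [exact I|]. intros Z e. cbn. now rewrite Ht.
Qed.

(** Whatever its complexity, a proposition without the variables is classically equivalent to [ftop]
    or [fbot]. [solve_def] tries this first. *)
Lemma def_const k (P : Prop) : definable k (fun _ _ => P).
Proof.
  destruct (classic P).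
  - exists ftop. split; [repeat split|]. intros; cbn; tauto.
  - exists fbot. split; [repeat split|]. intros; cbn; tauto.
Qed.

Lemma def_imp k p q : definable k p -> definable k q ->
  definable k (fun Z e => p Z e -> q Z e).
Proof.
  intros (A & HA & KA) (B & HB & KB). exists (fimp A B). split; [now split|].
  intros Z e. now apply sat_imp.
Qed.

Lemma def_not k p : definable k p -> definable k (fun Z e => ~ p Z e).
Proof.
  intros (A & HA & KA). exists (fneg A). split; [now split|].
  intros Z e. now apply sat_neg.
Qed.

Lemma def_and k p q : definable k p -> definable k q ->
  definable k (fun Z e => p Z e /\ q Z e).
Proof.
  intros (A & HA & KA) (B & HB & KB). exists (fand A B). split; [now repeat split|].
  intros Z e. now apply sat_and.
Qed.

Lemma def_or k p q : definable k p -> definable k q ->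
  definable k (fun Z e => p Z e \/ q Z e).
Proof.
  intros (A & HA & KA) (B & HB & KB). exists (fdis A B). split; [now repeat split|].
  intros Z e. now apply sat_or.
Qed.

Lemma def_iff k p q : definable k p -> definable k q ->
  definable k (fun Z e => p Z e <-> q Z e).
Proof.
  intros (A & HA & KA) (B & HB & KB). exists (fiff A B). split; [now repeat split|].
  intros Z e. now apply sat_iff.
Qed.

Lemma def_all k (p : M -> (M -> Prop) -> (nat -> M) -> Prop) :
  definable (S k) (fun Z e => p (e 0) Z (fun n => e (S n))) ->
  definable k (fun Z e => forall x, p x Z e).
Proof.
  intros (A & HA & KA). exists (alln A). split; [exact HA|]. intros Z e.
  apply sat_alln. intros x. rewrite comb_S. apply (KA Z (scons x e)).
Qed.

Lemma def_ex k (p : M -> (M -> Prop) -> (nat -> M) -> Prop) :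
  definable (S k) (fun Z e => p (e 0) Z (fun n => e (S n))) ->
  definable k (fun Z e => exists x, p x Z e).
Proof.
  intros (A & HA & KA). exists (exn A). split; [now repeat split|]. intros Z e.
  apply sat_exn. intros x. rewrite comb_S. apply (KA Z (scons x e)).
Qed.

(** Serves the recursion theorem, whose clause is a variable and therefore opaque to [solve_def]. *)
Lemma def_comp2 k (p : (M -> Prop) -> M -> M -> Prop) f g :
  definable 2 (fun Z e => p Z (e 0) (e 1)) -> tdefinable k f -> tdefinable k g ->
  definable k (fun Z e => p Z (f e) (g e)).
Proof.
  intros (A & HA & KA) [s Hs] [t Ht].
  exists (subst (scons s (scons t (fun n => tvar (k + n)))) (fun X => X) A).
  split; [now apply arithmetical_subst|]. intros Z e. rewrite sat_subst.
  rewrite <- (KA Z (scons (f e) (scons (g e) e))).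
  replace (comb 2 _) with
    (fun n => eval M (comb k e) (scons s (scons t (fun n => tvar (k + n))) n));
    [reflexivity|].
  extensionality n. destruct n as [|[|n]]; [apply Hs|apply Ht|]. cbn. unfold comb.
  destruct (Nat.ltb_spec (k + n) k); [lia|]. f_equal. cbn. lia.
Qed.

End Definability.

Create HintDb defn.
Create HintDb issets.

Ltac solve_tdef :=
  cbv beta;
  lazymatch goal with
  | |- tdefinable _ _ (fun e => e _) => apply tdef_var; lia
  | |- tdefinable _ _ (fun e => nadd _ _ _) => apply tdef_add; solve_tdef
  | |- tdefinable _ _ (fun e => nmul _ _ _) => apply tdef_mul; solve_tdef
  | |- tdefinable _ _ (fun _ => ?c) => apply tdef_const; assumption
  end.

Ltac solve_def :=
  repeat autounfold with defn; cbv beta;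
  first [apply def_const |
  lazymatch goal with
  | |- definable _ _ (fun Z e => Z _) => apply def_var_mem; solve_tdef
  | |- definable _ _ (fun Z e => _ = _) => apply def_eq; solve_tdef
  | |- definable _ _ (fun Z e => nlt _ _ _) => apply def_lt; solve_tdef
  | |- definable _ _ (fun Z e => _ <-> _) => apply def_iff; solve_def
  | |- definable _ _ (fun Z e => _ /\ _) => apply def_and; solve_def
  | |- definable _ _ (fun Z e => _ \/ _) => apply def_or; solve_def
  | |- definable _ _ (fun Z e => ~ _) => apply def_not; solve_def
  | |- definable _ _ (fun Z e => exists x, _) => apply def_ex; solve_def
  | |- definable _ _ (fun Z e => ?X _) => apply def_mem; [solve [eassumption | auto with issets]|solve_tdef]
  | |- definable _ _ (fun Z e => _) => first [apply def_all; solve_def | apply def_imp; solve_def]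
  end].

(** * Models of ATR_0 *)

Section Model.
Variable M : structure.
Hypothesis M_named : named M.
Hypothesis M_models : models M ATR0.

Declare Scope num_scope.
Local Open Scope num_scope.
Local Notation "0" := (nzero M) : num_scope.
Local Notation "1" := (nunity M) : num_scope.
Local Notation "x + y" := (nadd M x y) : num_scope.
Local Notation "x * y" := (nmul M x y) : num_scope.
Local Notation "x < y" := (nlt M x y) : num_scope.
Local Notation isset := (isset M).

Implicit Types (x y z a b c d i j k m n p q s t u : M) (X Y Z A B : M -> Prop).

Definition nle x y : Prop := x < y \/ x = y.
Local Notation "x <= y" := (nle x y) : num_scope.
Hint Unfold nle : defn.

Lemma s_env_isset (i : nat) : isset (s_env M i).
Proof. now exists i. Qed.

Lemma comprehension X : definable M 1 (fun _ e => X (e O)) -> isset X.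
Proof.
  intros (A & HA & KA).
  (* Set variable 0, which [definable] reserves for stages, receives an arbitrary set. *)
  assert (K := M_models _ (n_env M) (scons (s_env M O) (s_env M)) (ax_comprehension A HA)).
  eapply sat_exs in K.
  - destruct K as (Y & HY & K). replace X with Y; [exact HY|].
    extensionality x. apply propositional_extensionality. exact (K x).
  - intros Y _. apply sat_alln. intros x. apply sat_iff; [reflexivity|].
    unfold shifts. rewrite sat_subst.
    specialize (KA (s_env M O) (fun _ => x)). rewrite comb_1 in KA. exact KA.
  - intros [|i]; apply s_env_isset.
Qed.

(** The axiom speaks of sets only, so each induction inside the model carries a definability goal,
    which the tactic [ind] discharges. *)
Lemma induction X : definable M 1 (fun _ e => X (e O)) ->
  X 0 -> (forall n, X n -> X (n + 1)) -> forall n, X n.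
Proof.
  intros H. apply comprehension in H as [i ->]. intros H0 HS.
  assert (K := M_models _ (n_env M) (scons (s_env M i) (s_env M)) ax_induction).
  cbn in K. intros n. apply K; [intros [|]; apply s_env_isset|]. intros K'. now apply K'.
Qed.

Lemma axiom_holds (A : form) : ATR0 A -> forall x y, sat M (scons x (fun _ => y)) (s_env M) A.
Proof. intros H x y. apply M_models; auto. apply s_env_isset. Qed.

(** * Arithmetic, order and pairing in the model *)

Lemma succ_neq_0 x : x + 1 <> 0.
Proof. exact (axiom_holds _ ax_succ_nonzero x x). Qed.
Lemma succ_inj x y : x + 1 = y + 1 -> x = y.
Proof. exact (axiom_holds _ ax_succ_inj x y). Qed.
Lemma add_0_r x : x + 0 = x.
Proof. exact (axiom_holds _ ax_add_zero x x). Qed.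
Lemma add_succ_r x y : x + (y + 1) = (x + y) + 1.
Proof. exact (axiom_holds _ ax_add_succ x y). Qed.
Lemma mul_0_r x : x * 0 = 0.
Proof. exact (axiom_holds _ ax_mul_zero x x). Qed.
Lemma mul_succ_r x y : x * (y + 1) = x * y + x.
Proof. exact (axiom_holds _ ax_mul_succ x y). Qed.
Lemma nlt_0 x : ~ x < 0.
Proof. exact (axiom_holds _ ax_lt_zero x x). Qed.
Lemma lt_succ x y : x < y + 1 <-> x <= y.
Proof.
  assert (K := axiom_holds _ ax_lt_succ x y).
  eapply sat_iff in K; [exact K| |apply sat_or]; reflexivity.
Qed.

Ltac ind n := pattern n; apply induction; clear n; [solve_def| |].

Lemma add_assoc x y z : x + (y + z) = (x + y) + z.
Proof.
  ind z; [now rewrite !add_0_r|]. intros z IH. now rewrite !add_succ_r, IH.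
Qed.

Lemma add_0_l x : 0 + x = x.
Proof. ind x; [apply add_0_r|]. intros x IH. now rewrite add_succ_r, IH. Qed.

Lemma add_comm x y : x + y = y + x.
Proof.
  ind y; [now rewrite add_0_l, add_0_r|]. intros y IH.
  rewrite add_assoc, IH, <- !add_assoc. f_equal. clear IH.
  ind x; [now rewrite add_0_l, add_0_r|]. intros x IH. now rewrite add_assoc, IH.
Qed.

Lemma mul_add_r x y z : x * (y + z) = x * y + x * z.
Proof.
  ind z; [now rewrite mul_0_r, !add_0_r|]. intros z IH.
  now rewrite add_assoc, !mul_succ_r, IH, add_assoc.
Qed.

Lemma mul_0_l x : 0 * x = 0.
Proof. ind x; [apply mul_0_r|]. intros x IH. now rewrite mul_succ_r, IH, add_0_r. Qed.

Lemma mul_1_l x : 1 * x = x.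
Proof. ind x; [apply mul_0_r|]. intros x IH. now rewrite mul_succ_r, IH. Qed.

Lemma mul_comm x y : x * y = y * x.
Proof.
  ind y; [now rewrite mul_0_l, mul_0_r|]. intros y IH. rewrite mul_succ_r, IH. clear IH.
  ind x; [now rewrite !mul_0_r, add_0_r|]. intros x IH.
  rewrite !mul_succ_r, <- IH, <- !add_assoc. f_equal. rewrite !add_assoc. f_equal.
  apply add_comm.
Qed.

Lemma mul_add_l x y z : (x + y) * z = x * z + y * z.
Proof. rewrite !(mul_comm _ z). apply mul_add_r. Qed.

Lemma mul_assoc x y z : x * (y * z) = (x * y) * z.
Proof.
  ind z; [now rewrite !mul_0_r|]. intros z IH. now rewrite !mul_succ_r, mul_add_r, IH.
Qed.

Lemma num_semi_ring : semi_ring_theory 0 1 (nadd M) (nmul M) (@eq M).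
Proof.
  constructor; auto using add_0_l, add_comm, add_assoc, mul_1_l, mul_0_l, mul_comm,
    mul_assoc, mul_add_l.
Qed.

Add Ring num_ring : num_semi_ring.

Lemma num_cases n : n = 0 \/ exists m, n = m + 1.
Proof. ind n; [now left|]. intros n _. right. now exists n. Qed.

Lemma add_cancel_r x y z : x + z = y + z -> x = y.
Proof.
  revert x y. ind z; [intros x y; now rewrite !add_0_r|].
  intros z IH x y. rewrite !add_assoc. intros H. apply IH. now apply succ_inj.
Qed.

Lemma add_cancel_l x y z : z + x = z + y -> x = y.
Proof. rewrite !(add_comm z). apply add_cancel_r. Qed.

Lemma add_succ_neq x y : x <> x + (y + 1).
Proof.
  intros H. apply (succ_neq_0 y). apply (add_cancel_l _ _ x). now rewrite <- H, add_0_r.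
Qed.

(** Reduces the primitive order to equations, which [ring] can check. *)
Lemma lt_witness x y : x < y <-> exists d, y = x + (d + 1).
Proof.
  ind y.
  - split; [intros H; now apply nlt_0 in H|]. intros [d H].
    rewrite add_assoc in H. symmetry in H. now apply succ_neq_0 in H.
  - intros y IH. rewrite lt_succ. unfold nle. rewrite IH. split.
    + intros [[d ->]| ->]; [exists (d + 1)|exists 0]; ring.
    + intros [d Hd]. rewrite add_assoc in Hd. apply succ_inj in Hd.
      destruct (num_cases d) as [-> |[d' ->]].
      * right. now rewrite add_0_r in Hd.
      * left. now exists d'.
Qed.

Lemma le_witness x y : x <= y <-> exists d, y = x + d.
Proof.
  rewrite <- lt_succ, lt_witness. split; intros [d Hd]; exists d.
  - apply succ_inj. now rewrite Hd, add_assoc.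
  - now rewrite Hd, add_assoc.
Qed.

Lemma lt_irrefl x : ~ x < x.
Proof. rewrite lt_witness. intros [d Hd]. exact (add_succ_neq _ _ Hd). Qed.

Lemma lt_trans x y z : x < y -> y < z -> x < z.
Proof.
  rewrite !lt_witness. intros [d ->] [d' ->]. exists (d + 1 + d'). ring.
Qed.

Lemma lt_le_trans x y z : x < y -> y <= z -> x < z.
Proof. intros H [H'| <-]; auto. eapply lt_trans; eauto. Qed.

Lemma le_lt_trans x y z : x <= y -> y < z -> x < z.
Proof. intros [H'| ->] H; auto. eapply lt_trans; eauto. Qed.

Lemma le_trans x y z : x <= y -> y <= z -> x <= z.
Proof. intros [H| ->] H'; auto. left. eapply lt_le_trans; eauto. Qed.

Lemma lt_neq x y : x < y -> x <> y.
Proof. intros H ->. exact (lt_irrefl _ H). Qed.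

Lemma lt_asym x y : x < y -> ~ y < x.
Proof. intros H H'. exact (lt_irrefl _ (lt_trans _ _ _ H H')). Qed.

Lemma lt_succ_diag x : x < x + 1.
Proof. apply lt_succ. now right. Qed.

Lemma lt_le_succ x y : x < y <-> x + 1 <= y.
Proof.
  rewrite lt_witness, le_witness. split; intros [d ->]; exists d; ring.
Qed.

Lemma le_0 x : 0 <= x.
Proof. apply le_witness. exists x. ring. Qed.

Lemma lt_total x y : x < y \/ x = y \/ y < x.
Proof.
  ind y.
  - destruct (le_0 x) as [H| <-]; auto.
  - intros y [H|[-> |H]].
    + left. eapply lt_trans; [exact H|apply lt_succ_diag].
    + left. apply lt_succ_diag.
    + apply lt_le_succ in H as [H| ->]; auto.
Qed.

Lemma le_or_lt x y : x <= y \/ y < x.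
Proof. destruct (lt_total x y) as [H|[H|H]]; unfold nle; auto. Qed.

Lemma nlt_le x y : ~ x < y -> y <= x.
Proof. intros H. now destruct (le_or_lt y x). Qed.

Lemma le_antisym x y : x <= y -> y <= x -> x = y.
Proof. intros [H|H] [H'|H']; auto. now apply lt_asym in H. Qed.

Lemma mul_lt_mono x y z : x < y -> x * (z + 1) < y * (z + 1).
Proof.
  rewrite !lt_witness. intros [d ->]. exists (d * (z + 1) + z). ring.
Qed.

Lemma mul_le_mono x y z : x <= y -> x * z <= y * z.
Proof. rewrite !le_witness. intros [d ->]. exists (d * z). ring. Qed.

Lemma mul_le_cancel x y z : x * (z + 1) <= y * (z + 1) -> x <= y.
Proof.
  intros H. apply nlt_le. intros H'. apply (mul_lt_mono _ _ z) in H'.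
  exact (lt_irrefl _ (lt_le_trans _ _ _ H' H)).
Qed.

Lemma add_le_mono x y z w : x <= y -> z <= w -> x + z <= y + w.
Proof. rewrite !le_witness. intros [d ->] [d' ->]. exists (d + d'). ring. Qed.

Lemma add_le_cancel x y z : x + z <= y + z -> x <= y.
Proof.
  rewrite !le_witness. intros [d H]. exists d. apply (add_cancel_r _ _ z). rewrite H. ring.
Qed.

Lemma strong_induction X : definable M 1 (fun _ e => X (e O)) ->
  (forall n, (forall m, m < n -> X m) -> X n) -> forall n, X n.
Proof.
  intros HX H. apply comprehension in HX.
  assert (K : forall n m, m < n -> X m).
  { intros n. ind n; [intros m Hm; now apply nlt_0 in Hm|].
    intros n IH m Hm. apply lt_succ in Hm as [Hm| ->]; auto. }
  intros n. apply (K (n + 1)), lt_succ_diag.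
Qed.

Lemma least X : isset X -> (exists n, X n) ->
  exists n, X n /\ forall m, X m -> n <= m.
Proof.
  intros HX [n Hn]. apply NNPP. intros H. revert Hn.
  pattern n. apply strong_induction; [solve_def|]. clear n. intros n IH Hn.
  apply H. exists n. split; auto. intros m Hm. apply nlt_le. intros K. now apply (IH m).
Qed.

Definition pr s t : M := (s + t) * (s + t) + s.
Hint Unfold pr : defn.

(** A pair with sum [w] has its code between [w * w] and [w * w + w], hence below the next
    square. *)
Lemma pr_sum_le s t s' t' : pr s t = pr s' t' -> ~ s + t < s' + t'.
Proof.
  unfold pr. rewrite lt_witness. intros E [d Hd]. rewrite Hd in E.
  (* After cancelling the square of [s + t], equation [E] reads [s = s + (w + 1)] with this term as
     [w]. *)
  apply (add_succ_neq s ((s + t + t) * (d + 1) + s * d + d * (d + 1) + d + s')).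
  apply (add_cancel_l _ _ ((s + t) * (s + t))). rewrite E. ring.
Qed.

Lemma pr_inj s t s' t' : pr s t = pr s' t' -> s = s' /\ t = t'.
Proof.
  intros E. assert (K : s + t = s' + t').
  { destruct (lt_total (s + t) (s' + t')) as [H|[H|H]]; auto.
    - now apply pr_sum_le in H.
    - symmetry in E. now apply pr_sum_le in H. }
  unfold pr in E. rewrite K in E. apply add_cancel_l in E. subst s'. split; auto.
  now apply add_cancel_l in K.
Qed.

Lemma square_le x : x <= x * x.
Proof.
  destruct (num_cases x) as [-> |[y ->]].
  - rewrite mul_0_r. now right.
  - apply le_witness. exists ((y + 1) * y). ring.
Qed.

Lemma pr_le_l s t : s <= pr s t.
Proof. apply le_witness. exists ((s + t) * (s + t)). unfold pr. ring. Qed.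

Lemma pr_le_r s t : t <= pr s t.
Proof.
  apply le_trans with (s + t); [apply le_witness; exists s; ring|].
  apply le_trans with ((s + t) * (s + t)); [apply square_le|].
  apply le_witness. now exists s.
Qed.

(** * Transfinite recursion *)

Definition lt_in X i j : Prop := X (pr i j) /\ ~ X (pr j i).
Hint Unfold lt_in : defn.

Definition linear X : Prop :=
  (forall i j, X (pr i j) -> X (pr i i) /\ X (pr j j)) /\
  (forall i j k, X (pr i j) /\ X (pr j k) -> X (pr i k)) /\
  (forall i j, X (pr i j) /\ X (pr j i) -> i = j) /\
  (forall i j, X (pr i i) /\ X (pr j j) -> X (pr i j) \/ X (pr j i)).

Definition is_func (Dom Cod : M -> Prop) (f : M -> Prop) : Prop :=
  (forall z, f z -> exists x y, z = pr x y /\ Dom x /\ Cod y) /\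
  (forall x, Dom x -> exists y, f (pr x y) /\ forall y', f (pr x y') -> y' = y).

Definition well_ordered X : Prop :=
  linear X /\
  ~ exists f, isset f /\ is_func (fun _ => ~ False) (fun x => X (pr x x)) f /\
      forall n a b, f (pr n a) /\ f (pr (n + 1) b) -> lt_in X b a.

Lemma sat_linear e r (X : nat) : sat M e r (lin_order X) <-> linear (r X).
Proof. unfold lin_order, linear. cbv zeta. repeat sat_step. Qed.

Lemma sat_well_order e r (X : nat) : sat M e r (well_order X) <-> well_ordered (r X).
Proof.
  unfold well_order, well_ordered, is_func. apply sat_and; [apply sat_linear|].
  unfold func, ftop, strict, lt_in. repeat sat_step.
Qed.

Definition below X j Y z : Prop := Y z /\ exists m i, z = pr m i /\ lt_in X i j.

Lemma sat_restrict (A : form) : arithmetical A -> forall (X Y : nat) (j : term) e r,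
  sat M e r (restrict X Y j A)
  <-> sat M e (fun k : nat => if Nat.eqb k Y then below (r X) (eval M e j) (r Y) else r k) A.
Proof.
  induction A as [s t|s t|t Z| |A IHA B IHB|A IH|A IH]; cbn [arithmetical restrict];
    intros HA X Y j e r; try reflexivity.
  - cbn [sat]. destruct (Nat.eqb Z Y) eqn:E; [|reflexivity].
    apply Nat.eqb_eq in E. subst Z. apply sat_and; [reflexivity|].
    unfold strict; repeat sat_step; cbn; unfold tshift; rewrite !eval_subst; reflexivity.
  - destruct HA. cbn [sat]. rewrite IHA, IHB by auto. reflexivity.
  - cbn [sat]. apply all_iff. intros x. rewrite IH by auto.
    unfold tshift. rewrite eval_subst. reflexivity.
  - destruct HA.
Qed.

Lemma recursion_basic X (p : (M -> Prop) -> M -> Prop) :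
  isset X -> well_ordered X -> definable M 1 (fun Z e => p Z (e O)) ->
  exists Y, isset Y /\ forall z, Y z <->
    exists n j, z = pr n j /\ X (pr j j) /\ p (below X j Y) n.
Proof.
  intros HX WX (A & HA & KA).
  (* In [hierarchy] set variable 1 is [X]; the parameters of [A] make room for it, while the stage
     keeps the index 0. *)
  assert (Hth : arithmetical (subst tvar (ups S) A)) by now apply arithmetical_subst.
  assert (K : sat M (n_env M) (scons X (s_env M)) (exs (hierarchy (subst tvar (ups S) A)))).
  { apply (M_models _ (n_env M) (s_env M) (ax_recursion _ Hth) s_env_isset X HX).
    now apply sat_well_order. }
  apply (sat_exs M _ _ _ (fun Y => sat M (n_env M) (scons Y (scons X (s_env M)))
    (hierarchy (subst tvar (ups S) A)))) in K; [|intros; reflexivity].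
  destruct K as (Y & HY & K). exists Y. split; auto.
  unfold hierarchy in K. eapply sat_and in K; [|reflexivity|].
  2:{ apply sat_alln. intros z. apply sat_iff; [reflexivity|].
      apply sat_exn; intros n. apply sat_exn; intros j. apply sat_and; [reflexivity|].
      apply sat_and; [reflexivity|]. apply sat_restrict. now apply arithmetical_subst. }
  destruct K as [_ K]. intros z. rewrite (K z).
  apply ex_iff; intros n. apply ex_iff; intros j. cbn -[pr].
  apply and_iff_compat_l, and_iff_compat_l.
  rewrite !sat_subst. specialize (KA (below X j Y) (fun _ => n)).
  rewrite comb_1 in KA. rewrite <- KA.
  match goal with |- ?P <-> ?Q => enough (P = Q) as -> by reflexivity end. f_equal.
  - extensionality i. destruct i; reflexivity.
  - extensionality i. destruct i; reflexivity.
Qed.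

(* The axiom does not give the stage [j] to the recursion clause.  Putting [0]
   into every stage makes [j] recoverable, as the unique element of the field
   whose predecessors are the earlier stages. *)
Theorem recursion X (th : M -> M -> (M -> M -> Prop) -> Prop) :
  isset X -> well_ordered X ->
  definable M 2 (fun Z e => th (e O) (e (S O)) (fun m i => Z (pr (m + 1) i))) ->
  exists Y, isset Y /\ forall n j, X (pr j j) ->
    (Y (pr n j) <-> th n j (fun m i => lt_in X i j /\ Y (pr m i))).
Proof.
  intros HX WX Hth.
  destruct (recursion_basic X (fun Z n => n = 0 \/
    exists n' j, n = n' + 1 /\ X (pr j j) /\
      (forall i, X (pr i i) -> (lt_in X i j <-> Z (pr 0 i))) /\
      th n' j (fun m i => Z (pr (m + 1) i)))) as (Y0 & HY0 & K); auto.
  { assert (K := fun (k : nat) f g => def_comp2 M k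
      (fun Z n j => th n j (fun m i => Z (pr (m + 1) i))) f g Hth).
    apply def_or; [solve_def|]. do 2 apply def_ex. do 3 (apply def_and; [solve_def|]).
    apply (K 3 (fun e => e (S O)) (fun e => e O)); solve_tdef. }
  exists (fun z => exists n j, z = pr n j /\ Y0 (pr (n + 1) j)).
  split; [apply comprehension; solve_def|]. intros n j Hj.
  assert (E0 : forall i, X (pr i i) -> Y0 (pr 0 i)).
  { intros i Hi. apply K. exists 0, i. auto. }
  assert (E1 : forall i, X (pr i i) -> (lt_in X i j <-> below X j Y0 (pr 0 i))).
  { intros i Hi. split.
    - intros H. split; [now apply E0|]. now exists 0, i.
    - intros (_ & m & i' & E & H). apply pr_inj in E as [_ <-]. exact H. }
  assert (E2 : (fun m i => below X j Y0 (pr (m + 1) i)) =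
    (fun m i => lt_in X i j /\ exists n j, pr m i = pr n j /\ Y0 (pr (n + 1) j))).
  { extensionality m. extensionality i. apply propositional_extensionality. split.
    - intros (H & m' & i' & E & H'). apply pr_inj in E as [_ <-]. split; auto.
      now exists m, i.
    - intros (H & m' & i' & E & H'). apply pr_inj in E as [<- <-]. split; auto.
      now exists (m + 1), i. }
  rewrite <- E2. split.
  - intros (n' & j' & E & H). apply pr_inj in E as [<- <-].
    apply K in H as (n' & j' & E & _ & H). apply pr_inj in E as [<- <-].
    destruct H as [H|(n' & j' & E & Hj' & Hb & H)]; [now apply succ_neq_0 in H|].
    apply succ_inj in E as <-. enough (j' = j) as -> by exact H.
    destruct WX as ((_ & _ & anti & tot) & _).
    (* [j'] and [j] have the same predecessors; if they differed, the smaller one would precede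
       itself. *)
    assert (D : forall i, X (pr i i) -> (lt_in X i j' <-> lt_in X i j)).
    { intros i Hi. rewrite (Hb i Hi), (E1 i Hi). reflexivity. }
    destruct (D j Hj) as [D1 _], (D j' Hj') as [_ D2]. unfold lt_in in D1, D2.
    apply anti. destruct (tot j j'); tauto.
  - intros H. exists n, j. split; auto. apply K. exists (n + 1), j. split; auto.
    split; auto. right. exists n, j. auto.
Qed.

Definition le_set z : Prop := exists i j, z = pr i j /\ i <= j.

Lemma le_set_pr i j : le_set (pr i j) <-> i <= j.
Proof.
  split; [|now exists i, j]. intros (i' & j' & E & H). now apply pr_inj in E as [<- <-].
Qed.

Lemma le_set_isset : isset le_set.
Proof. apply comprehension. unfold le_set. solve_def. Qed.

Lemma lt_in_le_set i j : lt_in le_set i j <-> i < j.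
Proof.
  unfold lt_in. rewrite !le_set_pr. split.
  - intros [_ H]. now destruct (le_or_lt j i).
  - intros H. split; [now left|]. intros K. exact (lt_irrefl _ (lt_le_trans _ _ _ H K)).
Qed.

Lemma well_ordered_le_set : well_ordered le_set.
Proof.
  split.
  - unfold linear. repeat split.
    + apply le_set_pr. now right.
    + apply le_set_pr. now right.
    + intros i j k. rewrite !le_set_pr. intros [H1 H2]. eapply le_trans; eauto.
    + intros i j. rewrite !le_set_pr. intros [H1 H2]. now apply le_antisym.
    + intros i j _. rewrite !le_set_pr. destruct (le_or_lt i j) as [H|H]; auto.
      right. now left.
  - intros (f & Hf & (_ & F) & desc).
    destruct (least (fun a => exists n, f (pr n a))) as (a & [n Hn] & Ha).
    + apply comprehension. solve_def.
    + destruct (F 0) as (a & Ha & _); auto. now exists a, 0.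
    + destruct (F (n + 1)) as (b & Hb & _); auto.
      assert (K : b < a) by now apply lt_in_le_set, (desc n).
      exact (lt_irrefl _ (lt_le_trans _ _ _ K (Ha b (ex_intro _ _ Hb)))).
Qed.

(** Iterating an arithmetical clause along all numbers exceeds arithmetical comprehension in
    general, so it is obtained as transfinite recursion along [<=]. *)
Theorem nat_recursion (th : M -> M -> (M -> M -> Prop) -> Prop) :
  definable M 2 (fun Z e => th (e O) (e (S O)) (fun m i => Z (pr (m + 1) i))) ->
  exists Y, isset Y /\ forall n j,
    (Y (pr n j) <-> th n j (fun m i => i < j /\ Y (pr m i))).
Proof.
  intros Hth.
  destruct (recursion le_set th le_set_isset well_ordered_le_set Hth) as (Y & HY & K).
  exists Y. split; auto. intros n j. rewrite K by now apply le_set_pr; right.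
  match goal with |- th n j ?f <-> th n j ?g => enough (f = g) as -> by reflexivity end.
  extensionality m. extensionality i. apply propositional_extensionality.
  now rewrite lt_in_le_set.
Qed.

(** Always taking the least admissible successor makes the sequence unique, and recursion can then
    define it. *)
Lemma dependent_choice A S a0 : isset A -> isset S -> A a0 ->
  (forall a, A a -> exists b, A b /\ S (pr a b)) ->
  exists f, isset f /\ is_func (fun _ => ~ False) A f /\ f (pr 0 a0) /\
    forall n a b, f (pr n a) /\ f (pr (n + 1) b) -> S (pr a b).
Proof.
  intros HA HS Ha0 H.
  destruct (nat_recursion (fun b n W => n = 0 /\ b = a0 \/
    exists n' a, n = n' + 1 /\ W a n' /\ A b /\ S (pr a b) /\
      forall c, A c -> S (pr a c) -> b <= c)) as (Y & HY & K); [solve_def|].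
  assert (Y0 : forall b, Y (pr b 0) <-> b = a0).
  { intros b. rewrite K. split; auto.
    - intros [[_ E]|(n & a & E & _)]; auto. symmetry in E. now apply succ_neq_0 in E. }
  assert (YS : forall b n, Y (pr b (n + 1)) <->
    exists a, Y (pr a n) /\ A b /\ S (pr a b) /\ forall c, A c -> S (pr a c) -> b <= c).
  { intros b n. rewrite K. split.
    - intros [[E _]|(n' & a & E & (_ & H1) & H2)]; [now apply succ_neq_0 in E|].
      apply succ_inj in E as <-. now exists a.
    - intros (a & H1 & H2). right. exists n, a. split; auto. split; auto.
      split; auto. apply lt_succ_diag. }
  assert (F : forall n, exists a, A a /\ Y (pr a n) /\ forall b, Y (pr b n) -> b = a).
  { intros n. ind n.
    - exists a0. split; auto. split; [now apply Y0|]. intros b. apply Y0.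
    - intros n (a & Aa & Ya & Ua).
      destruct (least (fun b => A b /\ S (pr a b))) as (b & [Ab Sb] & Lb).
      + apply comprehension. solve_def.
      + auto.
      + exists b. split; auto. split.
        * apply YS. exists a. repeat split; auto.
        * intros c Hc. apply YS in Hc as (a' & Ha' & Ac & Sc & Lc).
          apply Ua in Ha' as ->. apply le_antisym; auto. }
  exists (fun z => exists n a, z = pr n a /\ Y (pr a n)).
  split; [apply comprehension; solve_def|]. split; [split|split].
  - intros z (n & a & -> & Ha). exists n, a. split; auto. split; auto.
    destruct (F n) as (b & Ab & Yb & Ub). now rewrite (Ub a).
  - intros n _. destruct (F n) as (a & Aa & Ya & Ua). exists a. split; [now exists n, a|].
    intros b (n' & b' & E & Hb). apply pr_inj in E as [<- <-]. auto.
  - exists 0, a0. split; auto. now apply Y0.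
  - intros n a b [(n' & a' & E & Ha) (n'' & b' & E' & Hb)].
    apply pr_inj in E as [<- <-]. apply pr_inj in E' as [<- <-].
    apply YS in Hb as (a' & Ha' & _ & Sb & _).
    destruct (F n) as (c & _ & _ & U). now rewrite (U a Ha), <- (U a' Ha').
Qed.

(** Otherwise every member of [A] has a strictly smaller one in [A], and dependent choice produces a
    descending sequence. *)
Lemma well_ordered_least X A : isset X -> well_ordered X -> isset A ->
  (exists a, A a) -> (forall a, A a -> X (pr a a)) ->
  exists a, A a /\ forall b, A b -> X (pr a b).
Proof.
  intros HX [(_ & _ & _ & tot) desc] HA [a0 Ha0] HAX. apply NNPP. intros H. apply desc.
  destruct (dependent_choice A (fun z => exists a b, z = pr a b /\ lt_in X b a) a0)
    as (f & Hf & (F1 & F2) & _ & K); auto.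
  - apply comprehension. solve_def.
  - intros a Aa. apply NNPP. intros H'. apply H. exists a. split; auto.
    intros b Ab. destruct (classic (X (pr a b))) as [|nab]; auto. exfalso. apply H'.
    exists b. split; auto. exists a, b. split; auto. split; auto.
    destruct (tot a b); auto. tauto.
  - exists f. split; auto. split; [split; auto|].
    + intros z Hz. destruct (F1 z Hz) as (x & y & -> & _ & Hy). exists x, y. auto.
    + intros n a b Hab. destruct (K n a b Hab) as (a' & b' & E & Hl).
      now apply pr_inj in E as [<- <-].
Qed.

(** * Finite sequences and trees *)

(* [0] codes the empty sequence; not every number codes a sequence. *)
Definition snoc s x : M := pr s x + 1.
Hint Unfold snoc : defn.

Lemma snoc_inj s x s' x' : snoc s x = snoc s' x' -> s = s' /\ x = x'.
Proof. intros E. now apply succ_inj, pr_inj in E. Qed.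

Lemma snoc_neq_0 s x : snoc s x <> 0.
Proof. apply succ_neq_0. Qed.

Lemma lt_snoc s x : s < snoc s x.
Proof. apply lt_succ, pr_le_l. Qed.

(** Recursion asserts only that such a set exists; [epsilon] fixes one, so that later definitions
    can refer to it. The other sets given by a [_spec] below follow this pattern. *)
Definition prefix_spec Y : Prop := isset Y /\ forall p s,
  Y (pr p s) <-> p = s \/ exists s' x, s = snoc s' x /\ Y (pr p s').

Definition prefix_set : M -> Prop := epsilon (inhabits (fun _ => False)) prefix_spec.

Lemma prefix_set_spec : prefix_spec prefix_set.
Proof.
  apply (epsilon_spec (inhabits (fun _ => False)) prefix_spec).
  destruct (nat_recursion (fun p s W => p = s \/ exists s' x, s = snoc s' x /\ W p s'))
    as (Y & HY & K); [solve_def|].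
  exists Y. split; auto. intros p s. rewrite K. split; (intros [H|(s' & x & E & H)]; [auto|]).
  - right. exists s', x. tauto.
  - right. exists s', x. subst s. auto using lt_snoc.
Qed.

Lemma prefix_set_isset : isset prefix_set.
Proof. apply prefix_set_spec. Qed.
Hint Resolve prefix_set_isset : issets.

Definition prefix p s : Prop := prefix_set (pr p s).
Hint Unfold prefix : defn.

Lemma prefix_iff p s : prefix p s <-> p = s \/ exists s' x, s = snoc s' x /\ prefix p s'.
Proof. apply prefix_set_spec. Qed.

Lemma prefix_refl s : prefix s s.
Proof. apply prefix_iff. now left. Qed.

Lemma prefix_snoc p s x : prefix p s -> prefix p (snoc s x).
Proof. intros H. apply prefix_iff. right. now exists s, x. Qed.

Lemma prefix_snoc_inv p s x : prefix p (snoc s x) -> p = snoc s x \/ prefix p s.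
Proof.
  intros H. apply prefix_iff in H as [H|(s' & y & E & H)]; auto.
  apply snoc_inj in E as [<- <-]. auto.
Qed.

Ltac strong_ind n := pattern n; apply strong_induction; clear n; [solve_def|].

Lemma prefix_trans s t u : prefix s t -> prefix t u -> prefix s u.
Proof.
  intros Hs. strong_ind u. intros u IH Ht.
  apply prefix_iff in Ht as [<- |(u' & x & -> & Ht)]; auto.
  apply prefix_snoc, IH; auto. apply lt_snoc.
Qed.

Lemma prefix_le p s : prefix p s -> p <= s.
Proof.
  strong_ind s. intros s IH H.
  apply prefix_iff in H as [<- |(s' & x & -> & H)]; [now right|].
  left. eapply le_lt_trans; [apply IH|]; auto using lt_snoc.
Qed.

Lemma prefix_antisym s t : prefix s t -> prefix t s -> s = t.
Proof. intros H1 H2. apply le_antisym; now apply prefix_le. Qed.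

Lemma snoc_not_prefix s x : ~ prefix (snoc s x) s.
Proof. intros H. apply prefix_le in H. exact (lt_irrefl _ (lt_le_trans _ _ _ (lt_snoc s x) H)). Qed.

Lemma prefix_total p q t : prefix p t -> prefix q t -> prefix p q \/ prefix q p.
Proof.
  strong_ind t. intros t IH Hp Hq.
  assert (Hp' := Hp). assert (Hq' := Hq).
  apply prefix_iff in Hp as [-> |(s & x & -> & Hp)]; auto.
  apply prefix_iff in Hq as [-> |(s' & x' & E & Hq)]; auto.
  apply snoc_inj in E as [<- <-]. apply (IH s); auto. apply lt_snoc.
Qed.

Lemma prefix_next p s : prefix p s -> p = s \/ exists x, prefix (snoc p x) s.
Proof.
  strong_ind s. intros s IH H.
  apply prefix_iff in H as [<- |(s' & x & -> & H)]; auto. right.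
  destruct (IH s') as [-> |[y Hy]]; auto using lt_snoc.
  - exists x. apply prefix_refl.
  - exists y. now apply prefix_snoc.
Qed.

Lemma prefix_branch p a b s : prefix (snoc p a) s -> prefix (snoc p b) s -> a = b.
Proof.
  intros H1 H2. assert (K : forall a b, prefix (snoc p a) (snoc p b) -> a = b).
  { clear a b H1 H2. intros a b H. apply prefix_snoc_inv in H as [H|H].
    - now apply snoc_inj in H.
    - now apply snoc_not_prefix in H. }
  destruct (prefix_total _ _ _ H1 H2) as [H|H]; apply K in H; auto.
Qed.

Lemma prefix_unsnoc p a s : prefix (snoc p a) s -> prefix p s.
Proof. apply prefix_trans, prefix_snoc, prefix_refl. Qed.

(** * Trees and the Kleene-Brouwer order *)

Definition tree T : Prop :=
  isset T /\ T 0 /\ forall s, T s -> s = 0 \/ exists s' x, s = snoc s' x /\ T s'.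

(** A path is a set of comparable nodes rather than a function; this is the form in which a
    descending sequence yields one. *)
Definition pathless T : Prop := ~ exists B, isset B /\ B 0 /\
  (forall s, B s -> T s /\ exists x, B (snoc s x)) /\
  (forall s t, B s -> B t -> prefix s t \/ prefix t s).

Section Tree.
Variable T : M -> Prop.
Hypothesis T_tree : tree T.

Lemma tree_isset : isset T.
Proof. apply T_tree. Qed.
Hint Resolve tree_isset : issets.

Lemma tree_unsnoc s x : T (snoc s x) -> T s.
Proof.
  intros H. apply T_tree in H as [H|(s' & y & E & H)]; [now apply snoc_neq_0 in H|].
  now apply snoc_inj in E as [<- <-].
Qed.

Lemma tree_prefix p s : prefix p s -> T s -> T p.
Proof.
  strong_ind s. intros s IH H Ts.
  apply prefix_iff in H as [<- |(s' & x & -> & H)]; auto.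
  apply (IH s'); auto using lt_snoc. now apply tree_unsnoc in Ts.
Qed.

Lemma tree_prefix_0 s : T s -> prefix 0 s.
Proof.
  strong_ind s. intros s IH Ts.
  destruct (proj2 (proj2 T_tree) s Ts) as [-> |(s' & x & -> & Ts')]; [apply prefix_refl|].
  apply prefix_snoc, IH; auto. apply lt_snoc.
Qed.

(* The Kleene-Brouwer order: extensions lie below their prefixes. *)
Definition kb_le s t : Prop :=
  prefix t s \/ exists p a b, a < b /\ prefix (snoc p a) s /\ prefix (snoc p b) t.
Hint Unfold kb_le : defn.
Definition kb z : Prop := exists s t, z = pr s t /\ T s /\ T t /\ kb_le s t.

Lemma kb_pr s t : kb (pr s t) <-> T s /\ T t /\ kb_le s t.
Proof.
  split; [|intros H; now exists s, t].
  intros (s' & t' & E & H). now apply pr_inj in E as [<- <-].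
Qed.

Lemma kb_isset : isset kb.
Proof. apply comprehension. unfold kb. solve_def. Qed.

(** When both comparisons come from branching points, these points are comparable. If they coincide,
    the entries there are ordered both ways; otherwise [s] and [t] still agree at the earlier one,
    where they should differ. *)
Lemma kb_le_antisym s t : kb_le s t -> kb_le t s -> s = t.
Proof.
  intros [H|(p & a & b & ab & Hs & Ht)] [K|(q & c & d & cd & Kt & Ks)].
  - now apply prefix_antisym.
  - exfalso. apply (lt_neq _ _ cd). apply (prefix_branch q c d s); auto.
    eapply prefix_trans; eauto.
  - exfalso. apply (lt_neq _ _ ab). apply (prefix_branch p a b t); auto.
    eapply prefix_trans; eauto.
  - exfalso. destruct (prefix_total p q s) as [H|H]; eauto using prefix_unsnoc.
    + apply prefix_next in H as [<- |[z H]].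
      * rewrite (prefix_branch _ _ _ _ Kt Ht), (prefix_branch _ _ _ _ Ks Hs) in cd.
        now apply lt_asym in cd.
      * apply (lt_neq _ _ ab). transitivity z.
        -- apply (prefix_branch p _ _ s); auto. eapply prefix_trans; [exact H|].
           eauto using prefix_unsnoc.
        -- apply (prefix_branch p _ _ t); auto. eapply prefix_trans; [exact H|].
           eauto using prefix_unsnoc.
    + apply prefix_next in H as [<- |[z H]].
      * rewrite (prefix_branch _ _ _ _ Kt Ht), (prefix_branch _ _ _ _ Ks Hs) in cd.
        now apply lt_asym in cd.
      * apply (lt_neq _ _ cd). transitivity z.
        -- apply (prefix_branch q _ _ t); auto. eapply prefix_trans; [exact H|].
           eauto using prefix_unsnoc.
        -- apply (prefix_branch q _ _ s); auto. eapply prefix_trans; [exact H|].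
           eauto using prefix_unsnoc.
Qed.

(** Of two branching points the earlier one decides; if they coincide, the order of the entries is
    transitive. *)
Lemma kb_le_trans s t u : kb_le s t -> kb_le t u -> kb_le s u.
Proof.
  intros [H|(p & a & b & ab & Hs & Ht)] [K|(q & c & d & cd & Kt & Ku)].
  - left. eapply prefix_trans; eauto.
  - right. exists q, c, d. repeat split; auto. eapply prefix_trans; eauto.
  - destruct (prefix_total u (snoc p b) t) as [L|L]; auto.
    + apply prefix_snoc_inv in L as [-> |L].
      * right. exists p, a, b. auto using prefix_refl.
      * left. eapply prefix_trans; [exact L|]. eauto using prefix_unsnoc.
    + right. now exists p, a, b.
  - right. destruct (prefix_total p q t) as [L|L]; eauto using prefix_unsnoc.
    + apply prefix_next in L as [<- |[z L]].
      * exists p, a, d. rewrite (prefix_branch _ _ _ _ Kt Ht) in cd.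
        repeat split; auto. eapply lt_trans; eauto.
      * assert (z = b) as ->.
        { apply (prefix_branch p _ _ t); auto. eapply prefix_trans; [exact L|].
          eauto using prefix_unsnoc. }
        exists p, a, b. repeat split; auto. eapply prefix_trans; [exact L|].
        eauto using prefix_unsnoc.
    + apply prefix_next in L as [<- |[z L]].
      * exists q, a, d. rewrite (prefix_branch _ _ _ _ Kt Ht) in cd.
        repeat split; auto. eapply lt_trans; eauto.
      * assert (z = c) as ->.
        { apply (prefix_branch q _ _ t); auto. eapply prefix_trans; [exact L|].
          eauto using prefix_unsnoc. }
        exists q, c, d. repeat split; auto. eapply prefix_trans; [exact L|].
        eauto using prefix_unsnoc.
Qed.

Lemma prefix_trichotomy s t : T s -> T t ->
  prefix s t \/ prefix t s \/
  exists p a b, a <> b /\ prefix (snoc p a) s /\ prefix (snoc p b) t.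
Proof.
  intros Ts Tt. revert Ts. strong_ind s. intros s IH Ts.
  destruct (proj2 (proj2 T_tree) s Ts) as [-> |(s' & x & -> & Ts')].
  - left. now apply tree_prefix_0.
  - destruct (IH s') as [H|[H|(p & a & b & ab & Hs & Ht)]]; auto using lt_snoc.
    + apply prefix_next in H as [-> |[y H]].
      * right. left. apply prefix_snoc, prefix_refl.
      * destruct (classic (x = y)) as [-> |xy]; auto.
        right. right. exists s', x, y. auto using prefix_refl.
    + right. left. now apply prefix_snoc.
    + right. right. exists p, a, b. auto using prefix_snoc.
Qed.

Lemma kb_le_total s t : T s -> T t -> kb_le s t \/ kb_le t s.
Proof.
  intros Ts Tt. destruct (prefix_trichotomy s t Ts Tt) as [H|[H|(p & a & b & ab & Hs & Ht)]].
  - right. now left.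
  - left. now left.
  - destruct (lt_total a b) as [L|[L|L]]; [|easy|].
    + left. right. now exists p, a, b.
    + right. right. now exists p, b, a.
Qed.

Lemma kb_linear : linear kb.
Proof.
  assert (R : forall s, kb_le s s) by (intros s; left; apply prefix_refl).
  repeat split.
  - apply kb_pr in H. apply kb_pr. generalize (R i). tauto.
  - apply kb_pr in H. apply kb_pr. generalize (R j). tauto.
  - intros i j k. rewrite !kb_pr. intros [H1 H2]. repeat split; try tauto.
    apply kb_le_trans with j; tauto.
  - intros i j. rewrite !kb_pr. intros [H1 H2]. apply kb_le_antisym; tauto.
  - intros i j. rewrite !kb_pr. intros [H1 H2].
    destruct (kb_le_total i j); tauto.
Qed.

Lemma kb_snoc s x : T (snoc s x) -> lt_in kb (snoc s x) s.
Proof.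
  intros H. assert (K : kb_le (snoc s x) s) by (left; apply prefix_snoc, prefix_refl).
  assert (Ts := tree_unsnoc _ _ H).
  split; [now apply kb_pr|]. rewrite kb_pr. intros (_ & _ & K').
  apply (lt_neq _ _ (lt_snoc s x)). now apply kb_le_antisym.
Qed.

(* The nodes that are prefixes of almost all members of a descending sequence
   form an infinite path. *)
Lemma kb_well_ordered : pathless T -> well_ordered kb.
Proof.
  intros HT. split; [apply kb_linear|]. intros (f & Hf & (F1 & F2) & desc). apply HT.
  assert (FT : forall n a, f (pr n a) -> T a).
  { intros n a H. destruct (F1 _ H) as (n' & a' & E & _ & K).
    apply pr_inj in E as [<- <-]. apply kb_pr in K. tauto. }
  assert (FE : forall n, exists a, f (pr n a)).
  { intros n. destruct (F2 n) as (a & Ha & _); eauto. }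
  assert (FU : forall n a b, f (pr n a) -> f (pr n b) -> a = b).
  { intros n a b Ha Hb. destruct (F2 n) as (c & _ & Uc); auto.
    now rewrite (Uc a Ha), (Uc b Hb). }
  assert (mono : forall d n a b, f (pr n a) -> f (pr (n + (d + 1)) b) ->
    kb_le b a /\ a <> b).
  { intros d n a b Ha. revert b. ind d.
    - intros b Hb. rewrite add_0_l in Hb. destruct (desc n a b (conj Ha Hb)) as [K1 K2].
      apply kb_pr in K1. split; [tauto|]. intros <-. apply K2, kb_pr. tauto.
    - intros d IH b Hb. destruct (FE (n + (d + 1))) as [c Hc].
      destruct (IH c Hc) as [K1 K2]. rewrite add_assoc in Hb.
      destruct (desc _ _ _ (conj Hc Hb)) as [K3 K4]. rewrite kb_pr in K3, K4.
      split; [apply kb_le_trans with c; tauto|]. intros <-. apply K4. tauto. }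
  assert (mono' : forall n m a b, n <= m -> f (pr n a) -> f (pr m b) -> kb_le b a).
  { intros n m a b [H| ->] Ha Hb.
    - apply lt_witness in H as [d ->]. now apply (mono d n).
    - rewrite (FU _ _ _ Ha Hb). left. apply prefix_refl. }
  exists (fun p => exists n, forall m a, n <= m -> f (pr m a) -> prefix p a).
  split; [apply comprehension; solve_def|]. split; [|split].
  - exists 0. intros m a _ Ha. apply tree_prefix_0. eauto.
  - intros p [n Hn]. split.
    { destruct (FE n) as [a Ha]. apply tree_prefix with a; eauto. apply (Hn n); auto. now right. }
    (* The member at [n] extends [p] and so lies below it or equals it; a strictly later member
       cannot climb back to [p]. *)
    assert (next : forall m a, n < m -> f (pr m a) -> exists x, prefix (snoc p x) a).
    { intros m a nm Ha. destruct (prefix_next p a) as [<- |]; auto.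
      { apply (Hn m); auto. now left. }
      exfalso. destruct (FE n) as [c Hc]. apply lt_witness in nm as [d ->].
      destruct (mono _ _ _ _ Hc Ha) as [K1 K2]. apply K2. symmetry.
      apply kb_le_antisym; auto. left. apply (Hn n); auto. now right. }
    (* Along a descending sequence the entry following [p] never increases, so its least value, once
       attained, is final. *)
    destruct (least (fun x => exists m a, n < m /\ f (pr m a) /\ prefix (snoc p x) a))
      as (x & (m0 & a0 & nm0 & Ha0 & Hx) & Lx).
    { apply comprehension. solve_def. }
    { destruct (FE (n + 1)) as [a Ha].
      destruct (next (n + 1) a (lt_succ_diag n) Ha) as [x Hx].
      exists x, (n + 1), a. auto using lt_succ_diag. }
    exists x, m0. intros m a mm Ha.
    assert (nm : n < m) by (eapply lt_le_trans; eauto).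
    destruct (next m a nm Ha) as [y Hy].
    destruct (Lx y) as [xy| ->]; auto; [exists m, a; auto|].
    exfalso. assert (E : a0 = a).
    { apply kb_le_antisym; [|eauto]. right. now exists p, x, y. }
    subst a0. apply (lt_neq _ _ xy). apply (prefix_branch p _ _ a); auto.
  - intros s t [n Hn] [m Hm]. destruct (FE (n + m)) as [a Ha].
    apply (prefix_total s t a).
    + apply (Hn (n + m)); auto. apply le_witness. now exists m.
    + apply (Hm (n + m)); auto. apply le_witness. exists n. ring.
Qed.

Hypothesis T_pathless : pathless T.

Theorem tree_recursion (th : M -> M -> (M -> M -> Prop) -> Prop) :
  definable M 2 (fun Z e => th (e O) (e (S O)) (fun m i => Z (pr (m + 1) i))) ->
  exists Y, isset Y /\ forall n s, T s ->
    (Y (pr n s) <-> th n s (fun m i => lt_in kb i s /\ Y (pr m i))).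
Proof.
  intros Hth.
  destruct (recursion kb th kb_isset (kb_well_ordered T_pathless) Hth) as (Y & HY & K).
  exists Y. split; auto. intros n s Ts. apply K, kb_pr. repeat split; auto.
  left. apply prefix_refl.
Qed.

(** The children of a least counterexample lie below it in the Kleene-Brouwer order, so they are no
    counterexamples. *)
Lemma tree_induction A : isset A ->
  (forall s, T s -> (forall x, T (snoc s x) -> A (snoc s x)) -> A s) ->
  forall s, T s -> A s.
Proof.
  intros HA H s Ts. apply NNPP. intros nA.
  destruct (well_ordered_least kb (fun s => T s /\ ~ A s)) as (t & [Tt nAt] & L).
  - apply kb_isset.
  - now apply kb_well_ordered.
  - apply comprehension. solve_def.
  - now exists s.
  - intros a [Ta _]. apply kb_pr. repeat split; auto. left. apply prefix_refl.
  - apply nAt, H; auto. intros x Tx. apply NNPP. intros nAx.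
    exact (proj2 (kb_snoc t x Tx) (L _ (conj Tx nAx))).
Qed.

End Tree.

Definition len_spec Y : Prop := isset Y /\ forall n s, Y (pr n s) <->
  s = 0 /\ n = 0 \/ exists s' x n', s = snoc s' x /\ n = n' + 1 /\ Y (pr n' s').

Definition len_set : M -> Prop := epsilon (inhabits (fun _ => False)) len_spec.

Lemma len_set_spec : len_spec len_set.
Proof.
  apply (epsilon_spec (inhabits (fun _ => False)) len_spec).
  destruct (nat_recursion (fun n s W => s = 0 /\ n = 0 \/
    exists s' x n', s = snoc s' x /\ n = n' + 1 /\ W n' s')) as (Y & HY & K); [solve_def|].
  exists Y. split; auto. intros n s. rewrite K.
  split; (intros [H|(s' & x & n' & E & E' & H)]; [auto|]).
  - right. exists s', x, n'. tauto.
  - right. exists s', x, n'. subst s. auto using lt_snoc.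
Qed.

Lemma len_set_isset : isset len_set.
Proof. apply len_set_spec. Qed.
Hint Resolve len_set_isset : issets.

(** A relation, because a number that codes no sequence has no length. *)
Definition len n s : Prop := len_set (pr n s).
Hint Unfold len : defn.

Lemma len_iff n s : len n s <->
  s = 0 /\ n = 0 \/ exists s' x n', s = snoc s' x /\ n = n' + 1 /\ len n' s'.
Proof. apply len_set_spec. Qed.

Lemma len_0 n : len n 0 <-> n = 0.
Proof.
  rewrite len_iff. split; auto. intros [[_ H]|(s & x & n' & E & _)]; auto.
  symmetry in E. now apply snoc_neq_0 in E.
Qed.

Lemma len_snoc n s x : len n (snoc s x) <-> exists n', n = n' + 1 /\ len n' s.
Proof.
  rewrite len_iff. split.
  - intros [[E _]|(s' & y & n' & E & -> & H)]; [now apply snoc_neq_0 in E|].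
    apply snoc_inj in E as [<- <-]. now exists n'.
  - intros (n' & -> & H). right. now exists s, x, n'.
Qed.

Lemma len_snoc_succ n s x : len n s -> len (n + 1) (snoc s x).
Proof. intros H. apply len_snoc. now exists n. Qed.

Lemma len_unique n m s : len n s -> len m s -> n = m.
Proof.
  revert n m. strong_ind s. intros s IH n m Hn Hm.
  apply len_iff in Hn as [[-> ->]|(s' & x & n' & -> & -> & Hn)].
  - apply len_0 in Hm. auto.
  - apply len_snoc in Hm as (m' & -> & Hm). f_equal. apply (IH s'); auto using lt_snoc.
Qed.

Lemma prefix_len p s n m : prefix p s -> len n p -> len m s -> p = s \/ n < m.
Proof.
  revert m. strong_ind s. intros s IH m Hp Hn Hm.
  apply prefix_iff in Hp as [<- |(s' & x & -> & Hp)]; auto. right.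
  apply len_snoc in Hm as (m' & -> & Hm). apply lt_succ.
  destruct (IH s' (lt_snoc _ _) m' Hp Hn Hm) as [-> |H]; [|now left].
  right. eapply len_unique; eauto.
Qed.

(** A prefix [snoc p x] of [s] with [len i p] expresses that [x] is the entry of [s] at index [i];
    entries are always addressed in this way. *)
Lemma entry_lt p x s i n : prefix (snoc p x) s -> len i p -> len n s -> i < n.
Proof.
  intros H Hi Hn. apply len_snoc_succ with (x := x) in Hi.
  destruct (prefix_len _ _ _ _ H Hi Hn) as [E|K].
  - rewrite E in Hi. rewrite (len_unique _ _ _ Hn Hi). apply lt_succ_diag.
  - eapply lt_trans; [apply lt_succ_diag|exact K].
Qed.

Lemma entry_exists s i n : len n s -> i < n -> exists p x, prefix (snoc p x) s /\ len i p.
Proof.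
  revert n. strong_ind s. intros s IH n Hn Hi.
  apply len_iff in Hn as [[-> ->]|(s' & x & n' & -> & -> & Hn)]; [now apply nlt_0 in Hi|].
  apply lt_succ in Hi as [Hi| ->].
  - destruct (IH s' (lt_snoc _ _) n' Hn Hi) as (p & y & H & K).
    exists p, y. split; auto. now apply prefix_snoc.
  - exists s', x. split; auto. apply prefix_refl.
Qed.

(** * Initial intervals *)

Definition partially_ordered P R : Prop :=
  (forall z, R z -> exists x y, z = pr x y /\ P x /\ P y) /\
  (forall x, P x -> R (pr x x)) /\
  (forall x y, R (pr x y) /\ R (pr y x) -> x = y) /\
  (forall x y z, R (pr x y) /\ R (pr y z) -> R (pr x z)).

Definition is_initial P R I : Prop :=
  (forall x, I x -> P x) /\ (forall x y, R (pr x y) /\ I y -> I x).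

Definition is_antichain P R A : Prop :=
  (forall x, A x -> P x) /\
  (forall x y, A x /\ A y /\ ~ x = y -> ~ R (pr x y) /\ ~ R (pr y x)).

Definition is_infinite A : Prop := forall k, exists i, k < i /\ A i.

Definition is_embedding Q O P R f : Prop :=
  is_func Q P f /\
  forall a b x y, f (pr a x) /\ f (pr b y) -> (O (pr a b) <-> R (pr x y)).

(** * Attempts to embed a linear order into the partial order *)

Section Capture.
Variables Q O P R : M -> Prop.
Hypothesis Q_isset : isset Q.
Hypothesis O_isset : isset O.
Hypothesis P_isset : isset P.
Hypothesis R_isset : isset R.
Hypothesis O_refl : forall i, Q i -> O (pr i i).
Hypothesis O_trans : forall i j k, Q i -> Q j -> Q k ->
  O (pr i j) -> O (pr j k) -> O (pr i k).
Hypothesis O_antisym : forall i j, Q i -> Q j -> O (pr i j) -> O (pr j i) -> i = j.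
Hypothesis O_total : forall i j, Q i -> Q j -> O (pr i j) \/ O (pr j i).
Hypothesis PR : partially_ordered P R.
Hypothesis no_antichain : ~ exists A, isset A /\ is_antichain P R A /\ is_infinite A.
Hypothesis no_embedding : ~ exists f, isset f /\ is_embedding Q O P R f.

Definition ltq i j : Prop := Q i /\ Q j /\ O (pr i j) /\ i <> j.
Definition ltp x y : Prop := R (pr x y) /\ x <> y.
Hint Unfold ltq ltp : defn.

Lemma ltq_trans i j k : ltq i j -> ltq j k -> ltq i k.
Proof.
  intros (Qi & Qj & H & n) (_ & Qk & H' & n'). repeat split; auto.
  - now apply (O_trans i j k).
  - intros <-. apply n. now apply O_antisym.
Qed.

Lemma ltq_irrefl i : ~ ltq i i.
Proof. intros (_ & _ & _ & H). now apply H. Qed.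

Lemma ltq_total i j : Q i -> Q j -> i <> j -> ltq i j \/ ltq j i.
Proof.
  intros Qi Qj n. destruct (O_total i j Qi Qj); [left|right]; repeat split; auto.
Qed.

Lemma ltp_trans x y z : ltp x y -> ltp y z -> ltp x z.
Proof.
  destruct PR as (_ & _ & anti & trans). intros [H n] [H' n']. split.
  - apply (trans x y z); auto.
  - intros <-. apply n. now apply anti.
Qed.

(* [s] lists the values of a partial embedding at the numbers below its length;
   [gap m s] is the set of admissible values at [m]. *)
Definition gap m s y : Prop := P y /\
  forall p x i, prefix (snoc p x) s -> len i p -> Q i ->
    (ltq i m -> ltp x y) /\ (ltq m i -> ltp y x).

(** Positions run through all numbers; one outside [Q] takes the dummy value 0, so an attempt can
    always get past it. *)
Definition legal p x : Prop := forall n, len n p -> (Q n -> gap n p x) /\ (~ Q n -> x = 0).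

Definition attempt s : Prop :=
  (exists n, len n s) /\ forall p x, prefix (snoc p x) s -> legal p x.
Hint Unfold gap legal : defn.

Lemma attempt_isset : isset attempt.
Proof. apply comprehension. unfold attempt. solve_def. Qed.
Hint Resolve attempt_isset : issets.

Lemma attempt_snoc s x : attempt (snoc s x) <-> attempt s /\ legal s x.
Proof.
  split.
  - intros [[n Hn] H]. split; [split|].
    + apply len_snoc in Hn as (n' & _ & Hn). now exists n'.
    + intros p y K. apply H. now apply prefix_snoc.
    + apply H, prefix_refl.
  - intros [[[n Hn] H] L]. split.
    + exists (n + 1). now apply len_snoc_succ.
    + intros p y K. apply prefix_snoc_inv in K as [K|K]; auto.
      now apply snoc_inj in K as [-> ->].
Qed.

Lemma attempt_tree : tree attempt.
Proof.
  split; [apply attempt_isset|]. split.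
  - split; [exists 0; now apply len_0|]. intros p x H.
    apply prefix_iff in H as [H|(s & y & H & _)].
    + now apply snoc_neq_0 in H.
    + symmetry in H. now apply snoc_neq_0 in H.
  - intros s H. assert (H' := H). destruct H as [[n Hn] _].
    apply len_iff in Hn as [[-> _]|(s' & x & _ & -> & _)]; auto. right.
    exists s', x. split; auto. now apply attempt_snoc in H'.
Qed.

(** Along a path every index in [Q] gets a value. Of two values the later one lies in a gap that the
    earlier one bounds, which puts it on the correct side. *)
Lemma attempt_pathless : pathless attempt.
Proof.
  intros (B & HB & B0 & BS & BC). apply no_embedding.
  assert (BL : forall n, exists s, B s /\ len n s).
  { intros n. ind n; [exists 0; split; auto; now apply len_0|].
    intros n (s & Bs & Hs). destruct (BS s Bs) as [_ [x Bx]].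
    exists (snoc s x). auto using len_snoc_succ. }
  assert (BU : forall n s t, B s -> B t -> len n s -> len n t -> s = t).
  { intros n s t Bs Bt Hs Ht. destruct (BC s t Bs Bt) as [K|K].
    - destruct (prefix_len _ _ _ _ K Hs Ht) as [|L]; auto. now apply lt_irrefl in L.
    - destruct (prefix_len _ _ _ _ K Ht Hs) as [|L]; auto. now apply lt_irrefl in L. }
  assert (BP : forall n m s t, B s -> B t -> len n s -> len m t -> n <= m -> prefix s t).
  { intros n m s t Bs Bt Hs Ht nm. destruct (BC s t Bs Bt) as [K|K]; auto.
    destruct (prefix_len _ _ _ _ K Ht Hs) as [-> |L]; [apply prefix_refl|].
    exfalso. exact (lt_irrefl _ (le_lt_trans _ _ _ nm L)). }
  set (f := fun z => exists q x s, z = pr q x /\ Q q /\ B s /\ len q s /\ B (snoc s x)).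
  assert (Ff : forall q x, f (pr q x) <-> exists s, Q q /\ B s /\ len q s /\ B (snoc s x)).
  { intros q x. split.
    - intros (q' & x' & s & E & H). apply pr_inj in E as [<- <-]. now exists s.
    - intros (s & H). now exists q, x, s. }
  assert (BG : forall q x s, Q q -> B s -> len q s -> B (snoc s x) -> gap q s x).
  { intros q x s Qq Bs Hs Bx. destruct (BS _ Bx) as [Ax _].
    apply attempt_snoc in Ax as [_ L]. now apply L. }
  destruct PR as (Rf & Rr & Ra & Rt).
  assert (main : forall a b x y, f (pr a x) -> f (pr b y) -> a < b ->
    (O (pr a b) <-> R (pr x y)) /\ (O (pr b a) <-> R (pr y x))).
  { intros a b x y Hx Hy ab. apply Ff in Hx as (s & Qa & Bs & Hs & Bx).
    apply Ff in Hy as (t & Qb & Bt & Ht & By).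
    destruct (BG b y t Qb Bt Ht By) as [_ G]. destruct (G s x a) as [G1 G2]; auto.
    { apply (BP (a + 1) b); auto using len_snoc_succ. now apply lt_le_succ. }
    assert (nab := lt_neq _ _ ab).
    (* Strict comparisons in the same direction settle both equivalences, the reverse ones by
       antisymmetry. *)
    assert (W : forall i j u v, ltq i j -> ltp u v ->
      (O (pr i j) <-> R (pr u v)) /\ (O (pr j i) <-> R (pr v u))).
    { intros i j u v (Qi & Qj & H1 & H2) [H3 H4]. split; [tauto|].
      split; intros H; exfalso; [apply H2|apply H4]; auto. }
    destruct (ltq_total a b Qa Qb nab) as [K|K].
    - apply W; auto.
    - apply and_comm. apply W; auto. }
  exists f. split; [apply comprehension; unfold f; solve_def|]. split; [split|].
  - intros z (q & x & s & -> & Qq & Bs & Hs & Bx). exists q, x. split; auto. split; auto.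
    apply (BG q x s); auto.
  - intros q Qq. destruct (BL q) as (s & Bs & Hs). destruct (BS s Bs) as [_ [x Bx]].
    exists x. split; [apply Ff; now exists s|]. intros x' Hx'.
    apply Ff in Hx' as (s' & _ & Bs' & Hs' & Bx').
    rewrite (BU q s' s) in Bx'; auto.
    apply (snoc_inj s x' s x), (BU (q + 1)); auto using len_snoc_succ.
  - intros a b x y [Hx Hy]. destruct (lt_total a b) as [ab|[<- |ab]].
    + apply (main a b x y); auto.
    + assert (x = y) as <-.
      { apply Ff in Hx as (s & Qa & Bs & Hs & Bx). apply Ff in Hy as (t & _ & Bt & Ht & By).
        rewrite (BU a t s) in By; auto.
        apply (snoc_inj s x s y), (BU (a + 1)); auto using len_snoc_succ. }
      apply Ff in Hx as (s & Qa & Bs & Hs & Bx).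
      split; intros _; auto. apply Rr, (BG a x s); auto.
    + apply (main b a y x); auto.
Qed.


(** * Small gaps *)

Definition same_gap n m : Prop := forall i, i < n -> Q i -> (ltq i n <-> ltq i m).
Hint Unfold same_gap : defn.

(** A gap is named by any unfilled index [m] lying in it, and [same_gap n m] says that the filled
    indices do not separate [m] from the next index [n]. In the last clause [m'] belongs to the gap
    of [n]; its side of [n] tells which half at [x] it names. *)
Definition small_spec Y : Prop := isset Y /\ forall m s n, attempt s -> len n s ->
  (Y (pr m s) <-> Q m /\ n <= m /\
    ((~ (Q n /\ same_gap n m) /\ exists x, attempt (snoc s x) /\ Y (pr m (snoc s x))) \/
     (Q n /\ same_gap n m /\ forall x, attempt (snoc s x) ->
        exists m', same_gap n m' /\ Y (pr m' (snoc s x))))).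

(* Bar recursion along the tree of attempts: [small m s] says that the gap at
   [m] has countably many initial intervals, up to incomparability. *)
Definition small_set : M -> Prop := epsilon (inhabits (fun _ => False)) small_spec.

Lemma small_set_spec : small_spec small_set.
Proof.
  apply (epsilon_spec (inhabits (fun _ => False)) small_spec).
  destruct (tree_recursion attempt attempt_tree attempt_pathless (fun m s W =>
    exists n, len n s /\ Q m /\ n <= m /\
    ((~ (Q n /\ same_gap n m) /\ exists x, attempt (snoc s x) /\ W m (snoc s x)) \/
     (Q n /\ same_gap n m /\ forall x, attempt (snoc s x) ->
        exists m', same_gap n m' /\ W m' (snoc s x))))) as (Y & HY & K); [solve_def|].
  exists Y. split; auto. intros m s n As Hn. rewrite K by auto. split.
  - intros (n' & Hn' & Qm & nm & H). rewrite (len_unique _ _ _ Hn' Hn) in *.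
    split; auto. split; auto. destruct H as [(H & x & Ax & _ & Hx)|(Qn & H & H')].
    + left. split; auto. now exists x.
    + right. split; auto. split; auto. intros x Ax.
      destruct (H' x Ax) as (m' & Sm & _ & Ym). now exists m'.
  - intros (Qm & nm & H). exists n. split; auto. split; auto. split; auto.
    destruct H as [(H & x & Ax & Hx)|(Qn & H & H')].
    + left. split; auto. exists x. split; auto. split; auto. apply kb_snoc; auto.
      apply attempt_tree.
    + right. split; auto. split; auto. intros x Ax.
      destruct (H' x Ax) as (m' & Sm & Ym). exists m'. split; auto. split; auto.
      apply kb_snoc; auto. apply attempt_tree.
Qed.

Lemma small_set_isset : isset small_set.
Proof. apply small_set_spec. Qed.
Hint Resolve small_set_isset : issets.

Definition small m s : Prop := small_set (pr m s).
Hint Unfold small : defn.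

Lemma small_iff m s n : attempt s -> len n s ->
  (small m s <-> Q m /\ n <= m /\
    ((~ (Q n /\ same_gap n m) /\ exists x, attempt (snoc s x) /\ small m (snoc s x)) \/
     (Q n /\ same_gap n m /\ forall x, attempt (snoc s x) ->
        exists m', same_gap n m' /\ small m' (snoc s x)))).
Proof. apply small_set_spec. Qed.

Lemma attempt_len s : attempt s -> exists n, len n s.
Proof. now intros [H _]. Qed.

Lemma small_snoc m s n x : attempt (snoc s x) -> len n s -> small m (snoc s x) ->
  Q m /\ n < m.
Proof.
  intros Ax Hn H. apply (small_iff m (snoc s x) (n + 1)) in H; auto using len_snoc_succ.
  destruct H as (Qm & H & _). split; auto. now apply lt_le_succ.
Qed.

(** If some child has a small gap other than a half of the gap of [n], that gap is small for [s]
    too. Otherwise every choice of a value leaves a small half, so the gap of [n] itself is small;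
    for a node without children this holds vacuously. An index [n] outside [Q] always allows the
    child [snoc s 0], whose small gap is of the first kind. *)
Lemma small_exists s : attempt s -> exists m, small m s.
Proof.
  apply (tree_induction attempt attempt_tree attempt_pathless
    (fun s => exists m, small m s)).
  { apply comprehension. solve_def. }
  clear s. intros s As IH. destruct (attempt_len s As) as [n Hn].
  destruct (classic (exists x m, attempt (snoc s x) /\ small m (snoc s x) /\
    ~ (Q n /\ same_gap n m))) as [(x & m & Ax & Dm & K)|K].
  { exists m. apply (small_iff m s n); auto. destruct (small_snoc m s n x Ax Hn Dm).
    split; auto. split; [now left|]. left. split; auto. now exists x. }
  assert (K' : forall x m, attempt (snoc s x) -> small m (snoc s x) ->
    Q n /\ same_gap n m).
  { intros x m Ax Dm. apply NNPP. intros K'. apply K. now exists x, m. }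
  destruct (classic (Q n)) as [Qn|nQn].
  - exists n. apply (small_iff n s n); auto. split; auto. split; [now right|].
    right. split; auto. split; [now intros i _ _|]. intros x Ax.
    destruct (IH x Ax) as [m Dm]. exists m. split; auto. exact (proj2 (K' x m Ax Dm)).
  - assert (A0 : attempt (snoc s 0)).
    { apply attempt_snoc. split; auto. intros n' Hn'.
      rewrite (len_unique _ _ _ Hn' Hn). split; [tauto|auto]. }
    destruct (IH 0 A0) as [m Dm]. exfalso. exact (nQn (proj1 (K' 0 m A0 Dm))).
Qed.

(** The hypothesis compares only the indices to the left of [a] and [b]. The right side follows by
    totality, as a filled index is less than [b] as a number and so differs from it. *)
Lemma gap_ext n a b s y : len n s -> n <= b -> Q b ->
  (forall i, i < n -> Q i -> (ltq i a <-> ltq i b)) -> gap b s y -> gap a s y.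
Proof.
  intros Hn nb Qb E [Py G]. split; auto. intros p x i Hp Hi Qi.
  destruct (G p x i Hp Hi Qi) as [G1 G2]. assert (lin := entry_lt _ _ _ _ _ Hp Hi Hn).
  specialize (E i lin Qi). split; [tauto|]. intros K. apply G2.
  assert (nib : i <> b) by (apply lt_neq; eapply lt_le_trans; eauto).
  destruct (ltq_total i b Qi Qb nib) as [L|L]; auto. apply E in L.
  exfalso. apply (ltq_irrefl i). eapply ltq_trans; eauto.
Qed.

Lemma gap_snoc m s n x y : len n s -> gap m s y ->
  (Q n -> (ltq n m -> ltp x y) /\ (ltq m n -> ltp y x)) -> gap m (snoc s x) y.
Proof.
  intros Hn [Py G] K. split; auto. intros p u i Hp Hi Qi.
  apply prefix_snoc_inv in Hp as [E|Hp]; [|now apply (G p)].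
  apply snoc_inj in E as [-> ->]. rewrite (len_unique _ _ _ Hi Hn) in *. auto.
Qed.

(* A value [i] that separates [m] from [n] already forces [y] to the correct
   side of [x]. *)
Lemma gap_snoc_apart m s n x y : len n s -> n < m -> Q m -> attempt (snoc s x) ->
  ~ (Q n /\ same_gap n m) -> gap m s y -> gap m (snoc s x) y.
Proof.
  intros Hn nm Qm Ax S G. apply (gap_snoc m s n); auto. intros Qn.
  apply attempt_snoc in Ax as [_ L]. destruct (L n Hn) as [Gx _].
  specialize (Gx Qn).
  assert (E : exists i, i < n /\ Q i /\ ~ (ltq i n <-> ltq i m)).
  { apply NNPP. intros E. apply S. split; auto. intros i lin Qi. apply NNPP. intros E'.
    apply E. now exists i. }
  destruct E as (i & lin & Qi & E).
  assert (nin := lt_neq _ _ lin). assert (nim := lt_neq _ _ (lt_trans _ _ _ lin nm)).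
  destruct (entry_exists s i n Hn lin) as (p & u & Hp & Hi).
  destruct (proj2 Gx p u i Hp Hi Qi) as [Gx1 Gx2].
  destruct (proj2 G p u i Hp Hi Qi) as [G1 G2].
  destruct (ltq_total i n Qi Qn nin) as [K|K];
    destruct (ltq_total i m Qi Qm nim) as [K'|K'].
  - tauto.
  - split; intros H.
    + exfalso. apply (ltq_irrefl i). eauto using ltq_trans.
    + eauto using ltp_trans.
  - split; intros H.
    + eauto using ltp_trans.
    + exfalso. apply (ltq_irrefl i). eauto using ltq_trans.
  - exfalso. apply E. split; intros H; exfalso; apply (ltq_irrefl i); eauto using ltq_trans.
Qed.

Definition apart_spec Y : Prop := isset Y /\ forall y c, Y (pr y c) <->
  c = 0 /\ P y \/
  exists c' x, c = snoc c' x /\ Y (pr y c') /\ ~ R (pr y x) /\ ~ R (pr x y).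

Definition apart_set : M -> Prop := epsilon (inhabits (fun _ => False)) apart_spec.

Lemma apart_set_spec : apart_spec apart_set.
Proof.
  apply (epsilon_spec (inhabits (fun _ => False)) apart_spec).
  destruct (nat_recursion (fun y c W => c = 0 /\ P y \/
    exists c' x, c = snoc c' x /\ W y c' /\ ~ R (pr y x) /\ ~ R (pr x y)))
    as (Y & HY & K); [solve_def|].
  exists Y. split; auto. intros y c. rewrite K.
  split; (intros [H|(c' & x & E & H)]; [auto|]).
  - right. exists c', x. tauto.
  - right. exists c', x. subst c. assert (L := lt_snoc c' x). tauto.
Qed.

Lemma apart_set_isset : isset apart_set.
Proof. apply apart_set_spec. Qed.
Hint Resolve apart_set_isset : issets.

(** For a sequence [c]: [y] is a point of [P] incomparable to every entry of [c]. In the end [c]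
    will list an antichain under construction. *)
Definition apart y c : Prop := apart_set (pr y c).
Hint Unfold apart : defn.

Lemma apart_0 y : P y -> apart y 0.
Proof. intros H. apply apart_set_spec. auto. Qed.

Lemma apart_snoc y c x : apart y (snoc c x) <-> apart y c /\ ~ R (pr y x) /\ ~ R (pr x y).
Proof.
  unfold apart. rewrite (proj2 apart_set_spec). split.
  - intros [[E _]|(c' & x' & E & H)]; [now apply snoc_neq_0 in E|].
    now apply snoc_inj in E as [<- <-].
  - intros H. right. now exists c, x.
Qed.

Lemma apart_prefix y p x c : prefix (snoc p x) c -> apart y c ->
  apart y p /\ ~ R (pr y x) /\ ~ R (pr x y).
Proof.
  strong_ind c. intros c IH Hp Hy.
  apply prefix_iff in Hp as [<- |(c' & z & -> & Hp)]; [now apply apart_snoc|].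
  apply (IH c'); auto using lt_snoc. now apply apart_snoc in Hy.
Qed.

Lemma apart_P y c : apart y c -> P y.
Proof.
  strong_ind c. intros c IH H. unfold apart in H.
  apply apart_set_spec in H as [[_ H]|(c' & x & -> & H & _)]; auto.
  apply (IH c'); auto using lt_snoc.
Qed.

(** * The fixed sequence of sets *)

Definition small_above s x : Prop := exists n m, len n s /\ same_gap n m /\
  ltq n m /\ small m (snoc s x).
Definition residual s y : Prop := exists n, len n s /\ gap n s y /\ ~ small_above s y.
Hint Unfold small_above residual : defn.

(** The numbers [e] act as expressions for finite unions of basic sets; the sets they denote need
    not be initial intervals. Pairing [e1] and [e2] by [snoc] makes both strictly smaller than the
    code of the union, as the recursion requires. *)
Definition gen_spec Y : Prop := isset Y /\ forall y e, Y (pr y e) <->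
  (exists x, e = pr 0 x /\ R (pr y x)) \/
  (exists s c, e = pr 1 (pr s c) /\ residual s y /\ apart y c) \/
  (exists e1 e2, e = pr (1 + 1) (snoc e1 e2) /\ (Y (pr y e1) \/ Y (pr y e2))).

Definition gen_set : M -> Prop := epsilon (inhabits (fun _ => False)) gen_spec.

Lemma gen_set_spec : gen_spec gen_set.
Proof.
  apply (epsilon_spec (inhabits (fun _ => False)) gen_spec).
  destruct (nat_recursion (fun y e W =>
    (exists x, e = pr 0 x /\ R (pr y x)) \/
    (exists s c, e = pr 1 (pr s c) /\ residual s y /\ apart y c) \/
    (exists e1 e2, e = pr (1 + 1) (snoc e1 e2) /\ (W y e1 \/ W y e2))))
    as (Y & HY & K); [solve_def|].
  exists Y. split; auto. intros y e. rewrite K.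
  split; (intros [H|[H|(e1 & e2 & E & H)]]; auto); right; right; exists e1, e2; [tauto|].
  split; auto. subst e.
  assert (L : snoc e1 e2 <= pr (1 + 1) (snoc e1 e2)) by apply pr_le_r.
  assert (e1 < pr (1 + 1) (snoc e1 e2)) by (eapply lt_le_trans; [apply lt_snoc|exact L]).
  assert (e2 < pr (1 + 1) (snoc e1 e2)).
  { eapply lt_le_trans; [|exact L]. apply lt_succ, pr_le_r. }
  tauto.
Qed.

Lemma gen_set_isset : isset gen_set.
Proof. apply gen_set_spec. Qed.
Hint Resolve gen_set_isset : issets.

Definition gen y e : Prop := gen_set (pr y e).
Hint Unfold gen : defn.

Lemma one_neq_zero : 1 <> 0.
Proof. rewrite <- (add_0_l 1). apply succ_neq_0. Qed.

Lemma two_neq_one : 1 + 1 <> 1.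
Proof.
  intros E. apply one_neq_zero. apply (add_cancel_r _ _ 1). now rewrite add_0_l.
Qed.

Lemma gen_down y x : gen y (pr 0 x) <-> R (pr y x).
Proof.
  unfold gen. rewrite (proj2 gen_set_spec). split.
  - intros [(x' & E & H)|[(s & c & E & _)|(e1 & e2 & E & _)]]; apply pr_inj in E as [E E'].
    + now subst x'.
    + symmetry in E. now apply one_neq_zero in E.
    + symmetry in E. now apply succ_neq_0 in E.
  - intros H. left. now exists x.
Qed.

Lemma gen_residual y s c : gen y (pr 1 (pr s c)) <-> residual s y /\ apart y c.
Proof.
  unfold gen. rewrite (proj2 gen_set_spec). split.
  - intros [(x' & E & H)|[(s' & c' & E & H)|(e1 & e2 & E & _)]]; apply pr_inj in E as [E E'].
    + now apply one_neq_zero in E.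
    + now apply pr_inj in E' as [<- <-].
    + symmetry in E. now apply two_neq_one in E.
  - intros H. right. left. now exists s, c.
Qed.

Lemma gen_union y e1 e2 : gen y (pr (1 + 1) (snoc e1 e2)) <-> gen y e1 \/ gen y e2.
Proof.
  unfold gen at 1. rewrite (proj2 gen_set_spec). split.
  - intros [(x' & E & H)|[(s' & c' & E & H)|(e1' & e2' & E & H)]];
      apply pr_inj in E as [E E'].
    + now apply succ_neq_0 in E.
    + now apply two_neq_one in E.
    + now apply snoc_inj in E' as [<- <-].
  - intros H. right. right. now exists e1, e2.
Qed.

(** * Covering a given initial interval *)

Section Interval.
Variable I : M -> Prop.
Hypothesis I_isset : isset I.
Hypothesis I_initial : is_initial P R I.

(** Outside [A] the set of [e] is free as long as it stays within [I]. This makes covers stable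
    under unions and under shrinking [A]. *)
Definition covers e (A : M -> Prop) : Prop :=
  (forall y, A y -> I y -> gen y e) /\ (forall y, gen y e -> I y).
Hint Unfold covers : defn.

Lemma covers_sub e A B : (forall y, B y -> I y -> A y) -> covers e A -> covers e B.
Proof. intros H [H1 H2]. split; auto. Qed.

Lemma covers_union e1 e2 A B : covers e1 A -> covers e2 B ->
  covers (pr (1 + 1) (snoc e1 e2)) (fun y => A y \/ B y).
Proof.
  intros [H1 H2] [H3 H4]. split; intros y; rewrite gen_union.
  - intros [H|H] Hy; auto.
  - intros [H|H]; auto.
Qed.

Lemma covers_down x A : I x -> (forall y, A y -> I y -> R (pr y x)) -> covers (pr 0 x) A.
Proof.
  intros Ix H. split; intros y; rewrite gen_down; auto.
  intros K. apply (proj2 I_initial y x). auto.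
Qed.

(* Either every point [x] of the gap obeys the rule "[x] is in [I] unless the
   part above [x] is small", and then [I] is the residual set there, or a point
   breaking the rule splits off a small half of the gap. *)
Lemma covers_gap c :
  (forall x, apart x c -> exists e, covers e (fun y => apart y (snoc c x))) ->
  forall s, attempt s ->
  forall m, small m s -> exists e, covers e (fun y => apart y c /\ gap m s y).
Proof.
  intros Hc. apply (tree_induction attempt attempt_tree attempt_pathless (fun s =>
    forall m, small m s -> exists e, covers e (fun y => apart y c /\ gap m s y))).
  { apply comprehension. solve_def. }
  intros s As IH m Dm. destruct (attempt_len s As) as [n Hn].
  destruct (proj1 (small_iff m s n As Hn) Dm)
    as (Qm & nm & [(S & x & Ax & Dx)|(Qn & S & Dn)]).
  (* Here [n] is outside [Q] or outside the gap of [m], so the value [x] does not narrow that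
     gap. *)
  { destruct (IH x Ax m Dx) as [e He]. exists e. revert He. apply covers_sub.
    intros y [Hy Gy] _. split; auto. apply (gap_snoc_apart m s n); auto.
    now apply (small_snoc m s n x). }
  enough (exists e, covers e (fun y => apart y c /\ gap n s y)) as [e He].
  { exists e. revert He. apply covers_sub. intros y [Hy Gy] _. split; auto.
    now apply (gap_ext n n m). }
  assert (Ag : forall x, gap n s x -> attempt (snoc s x)).
  { intros x Gx. apply attempt_snoc. split; auto. intros n' Hn'.
    rewrite (len_unique _ _ _ Hn' Hn). split; tauto. }
  (* The induction hypothesis covers the small half at [x], and [Hc] the points incomparable to
     [x]. *)
  assert (half : forall x m', apart x c -> gap n s x -> same_gap n m' ->
    small m' (snoc s x) -> exists e, covers e (fun y => apart y c /\ gap n s y /\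
      ((ltq n m' -> ltp x y) /\ (ltq m' n -> ltp y x) \/ ~ R (pr y x) /\ ~ R (pr x y)))).
  { intros x m' Hx Gx S' Dm'. assert (Ax := Ag x Gx).
    destruct (IH x Ax m' Dm') as [e1 He1], (Hc x Hx) as [e2 He2].
    destruct (small_snoc m' s n x Ax Hn Dm') as [Qm' nm'].
    exists (pr (1 + 1) (snoc e1 e2)).
    eapply covers_sub; [|exact (covers_union _ _ _ _ He1 He2)].
    cbv beta. intros y (Hy & Gy & [K|K]) _; [left|right; apply apart_snoc; auto].
    split; auto. apply (gap_snoc m' s n); auto. apply (gap_ext n m' n); auto; [now right|].
    intros i lin Qi. symmetry. now apply S'. }
  (* The rule excludes [x], but [x] is in [I]: a principal interval takes the points below [x], and
     the half above is small. *)
  destruct (classic (exists x, apart x c /\ gap n s x /\ small_above s x /\ I x))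
    as [(x & Hx & Gx & (n' & m' & Hn' & S' & L & Dm') & Ix)|K1].
  { rewrite (len_unique _ _ _ Hn' Hn) in *. destruct (half x m' Hx Gx S' Dm') as [e He].
    exists (pr (1 + 1) (snoc (pr 0 x) e)). eapply covers_sub; [|apply covers_union; [|exact He]].
    2:{ apply (covers_down x (fun y => R (pr y x))); auto. }
    cbv beta. intros y [Hy Gy] _. destruct (classic (R (pr y x))) as [|nyx]; auto. right.
    split; auto. split; auto. destruct (classic (R (pr x y))) as [xy|nxy]; auto. left. split.
    - intros _. split; auto. intros <-. contradiction.
    - intros L'. exfalso. apply (ltq_irrefl n). eapply ltq_trans; eauto. }
  (* The rule admits [x], but [x] is not in [I]: then [I] has no points above [x], and the small
     half that [x] must leave is the lower one. *)
  destruct (classic (exists x, apart x c /\ gap n s x /\ ~ small_above s x /\ ~ I x))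
    as [(x & Hx & Gx & nA & nI)|K2].
  { destruct (Dn x (Ag x Gx)) as (m' & S' & Dm').
    destruct (small_snoc m' s n x (Ag x Gx) Hn Dm') as [Qm' nm'].
    assert (L : ~ ltq n m').
    { intros L. apply nA. now exists n, m'. }
    destruct (half x m' Hx Gx S' Dm') as [e He]. exists e. revert He. apply covers_sub.
    intros y [Hy Gy] Iy. split; auto. split; auto.
    assert (nxy : ~ R (pr x y)).
    { intros xy. apply nI. apply (proj2 I_initial x y). auto. }
    destruct (classic (R (pr y x))) as [yx|nyx]; auto. left. split; [tauto|].
    intros _. split; auto. intros ->. contradiction. }
  exists (pr 1 (pr s c)). split; intros y; rewrite gen_residual.
  - intros [Hy Gy] Iy. split; auto. exists n. split; auto. split; auto.
    intros Sy. apply K1. now exists y.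
  - intros [(n' & Hn' & Gy & nS) Hy]. rewrite (len_unique _ _ _ Hn' Hn) in *.
    apply NNPP. intros nI. apply K2. now exists y.
Qed.

Lemma covers_apart c :
  (forall x, apart x c -> exists e, covers e (fun y => apart y (snoc c x))) ->
  exists e, covers e (fun y => apart y c).
Proof.
  intros Hc. assert (A0 : attempt 0) by apply attempt_tree.
  destruct (small_exists 0 A0) as [m Dm]. destruct (covers_gap c Hc 0 A0 m Dm) as [e He].
  exists e. revert He. apply covers_sub. intros y Hy _. split; auto. split.
  - now apply apart_P in Hy.
  - intros p x i Hp. exfalso. apply prefix_le in Hp as [Hp|Hp].
    + now apply nlt_0 in Hp.
    + now apply snoc_neq_0 in Hp.
Qed.

(** If [P] itself were not covered, [covers_apart] would allow prolonging uncovered sequences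
    forever by points apart from them, and the added points would form an infinite antichain. *)
Lemma covers_all : exists e, forall y, I y <-> gen y e.
Proof.
  enough (exists e, covers e (fun y => apart y 0)) as (e & H1 & H2).
  { exists e. intros y. split; auto. intros Iy. apply H1; auto. apply apart_0.
    now apply I_initial. }
  apply NNPP. intros H0. apply no_antichain.
  destruct (dependent_choice (fun c => ~ exists e, covers e (fun y => apart y c))
    (fun z => exists c x, z = pr c (snoc c x) /\ apart x c) 0)
    as (f & Hf & (_ & F) & _ & K); auto.
  { apply comprehension. solve_def. }
  { apply comprehension. solve_def. }
  { intros c nc. apply NNPP. intros H. apply nc. apply covers_apart. intros x Hx.
    apply NNPP. intros nx. apply H. exists (snoc c x). split; auto. now exists c, x. }
  set (val := fun n x => exists c, f (pr n c) /\ f (pr (n + 1) (snoc c x))).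
  assert (V : forall n c, f (pr n c) -> exists x, f (pr (n + 1) (snoc c x)) /\ apart x c).
  { intros n c Hc. destruct (F (n + 1)) as (d & Hd & _); auto.
    destruct (K n c d (conj Hc Hd)) as (c' & x & E & Hx). apply pr_inj in E as [<- ->].
    now exists x. }
  assert (FU : forall n c d, f (pr n c) -> f (pr n d) -> c = d).
  { intros n c d Hc Hd. destruct (F n) as (u & _ & U); auto. now rewrite (U c), (U d). }
  assert (pre : forall d n c c', f (pr n c) -> f (pr (n + d) c') -> prefix c c').
  { intros d n c c' Hc. revert c'. ind d.
    - intros c' Hc'. rewrite add_0_r in Hc'. rewrite (FU n c c'); auto using prefix_refl.
    - intros d IH c' Hc'. destruct (F (n + d)) as (u & Hu & _); auto.
      destruct (V _ _ Hu) as (x & Hx & _). rewrite add_assoc in Hc'.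
      rewrite (FU _ _ _ Hc' Hx). apply prefix_snoc. auto. }
  assert (inc : forall n m x y, n < m -> val n x -> val m y -> ~ R (pr x y) /\ ~ R (pr y x)).
  { intros n m x y nm (c & Hc & Hx) (d & Hd & Hy).
    apply lt_witness in nm as [k ->].
    assert (Hp : prefix (snoc c x) d).
    { apply (pre k (n + 1)); auto. replace (n + 1 + k) with (n + (k + 1)) by ring. auto. }
    destruct (V _ _ Hd) as (y' & Hy' & Ay). assert (E := FU _ _ _ Hy Hy').
    apply snoc_inj in E as [_ <-]. destruct (apart_prefix _ _ _ _ Hp Ay) as (_ & H1 & H2).
    auto. }
  assert (VP : forall n x, val n x -> P x).
  { intros n x (c & Hc & Hx). destruct (V _ _ Hc) as (y & Hy & Ay).
    assert (E := FU _ _ _ Hx Hy). apply snoc_inj in E as [_ <-]. now apply apart_P in Ay. }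
  assert (VE : forall n, exists x, val n x).
  { intros n. destruct (F n) as (c & Hc & _); auto. destruct (V _ _ Hc) as (x & Hx & _).
    now exists x, c. }
  exists (fun x => exists n, val n x).
  split; [apply comprehension; unfold val; solve_def|]. split; [split|].
  - intros x [n Hx]. eauto.
  - intros x y ([n Hx] & [m Hy] & nxy). destruct (lt_total n m) as [L|[<- |L]].
    + eauto.
    + exfalso. apply nxy. destruct Hx as (c & Hc & Hx), Hy as (d & Hd & Hy).
      assert (E := FU _ _ _ Hc Hd). subst d. assert (E := FU _ _ _ Hx Hy).
      now apply snoc_inj in E as [_ <-].
    + apply and_comm. eauto.
  - intros k. apply NNPP. intros H.
    (* Unboundedness of the values is shown by induction on [j]: each number is a value at most
       once, so the values eventually pass [j]. *)
    assert (B : forall j, exists N, forall n x, N <= n -> val n x -> j <= x).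
    { intros j. unfold val. ind j; fold val.
      - exists 0. intros n x _ _. apply le_0.
      - intros j [N HN]. destruct (classic (exists n, N <= n /\ val n j)) as [(n0 & Nn & Hn)|E].
        + exists (n0 + 1). intros n x nn Hx. apply lt_le_succ in nn.
          assert (Nn' : N <= n) by (left; eapply le_lt_trans; eauto).
          apply lt_le_succ. destruct (HN n x Nn' Hx) as [|<-]; auto. exfalso.
          destruct (inc n0 n j j nn Hn Hx) as [H' _]. apply H', PR. eauto.
        + exists N. intros n x Nn Hx. apply lt_le_succ.
          destruct (HN n x Nn Hx) as [|<-]; auto. exfalso. apply E. now exists n. }
    destruct (B (k + 1)) as [N HN]. destruct (VE N) as [x Hx]. apply H. exists x.
    split; [|now exists N]. apply lt_le_succ. apply (HN N); auto. now right.
Qed.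

End Interval.
Theorem intervals_countable : exists J, isset J /\
  forall I, isset I -> is_initial P R I -> exists n, forall x, I x <-> J (pr x n).
Proof.
  exists gen_set. split; [apply gen_set_isset|]. intros I HI iI.
  exact (covers_all I HI iI).
Qed.

End Capture.

(** * The rationals *)

Definition rle a b : Prop := exists m n k m' n' k',
  a = pr (pr m n) k /\ b = pr (pr m' n') k' /\
  m * (k' + 1) + n' * (k + 1) <= m' * (k + 1) + n * (k' + 1).

Definition rational a : Prop := rle a a /\ forall u, u < a -> ~ (rle u a /\ rle a u).

Lemma rle_total a b : rle a a -> rle b b -> rle a b \/ rle b a.
Proof.
  intros (m & n & k & _ & _ & _ & Ea & _) (m' & n' & k' & _ & _ & _ & Eb & _).
  destruct (le_or_lt (m * (k' + 1) + n' * (k + 1)) (m' * (k + 1) + n * (k' + 1))) as [H|H].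
  - left. now exists m, n, k, m', n', k'.
  - right. exists m', n', k', m, n, k. split; auto. split; auto. now left.
Qed.

Lemma rle_trans a b c : rle a b -> rle b c -> rle a c.
Proof.
  intros (m & n & k & m' & n' & k' & Ea & Eb & H)
    (m1 & n1 & k1 & m2 & n2 & k2 & Eb' & Ec & H').
  subst b. apply pr_inj in Eb' as [E <-]. apply pr_inj in E as [<- <-].
  exists m, n, k, m2, n2, k2. split; auto. split; auto.
  (* Scaling by the middle denominator and adding the middle numerators turns the goal into the sum
     of the two hypotheses, each scaled by the denominator it lacks. *)
  apply (mul_le_cancel _ _ k').
  apply (add_le_cancel _ _ ((m' + n') * (k + 1) * (k2 + 1))).
  apply (mul_le_mono _ _ (k2 + 1)) in H. apply (mul_le_mono _ _ (k + 1)) in H'.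
  assert (K := add_le_mono _ _ _ _ H H').
  match type of K with ?u <= ?v =>
    match goal with |- ?u' <= ?v' => replace u' with u by ring; replace v' with v by ring end
  end. exact K.
Qed.

Lemma rle_antisym a b : rational a -> rational b -> rle a b -> rle b a -> a = b.
Proof.
  intros [_ Ha] [_ Hb] ab ba. destruct (lt_total a b) as [H|[H|H]]; auto; exfalso.
  - now apply (Hb a).
  - now apply (Ha b).
Qed.

Lemma sat_qle e r (s t : term) : sat M e r (qle s t) <-> rle (eval M e s) (eval M e t).
Proof.
  unfold qle, rle. cbv zeta. repeat sat_step; cbn; unfold tshift; rewrite ?eval_subst;
    reflexivity.
Qed.

Lemma sat_isQ e r (t : term) : sat M e r (isQ t) <-> rational (eval M e t).
Proof.
  unfold isQ, rational. cbv zeta. apply sat_and; [apply sat_qle|].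
  apply sat_alln. intros u. apply sat_imp.
  - cbn. unfold tshift. rewrite eval_subst. reflexivity.
  - apply sat_neg, sat_and; rewrite sat_qle; unfold tshift; rewrite eval_subst; reflexivity.
Qed.

Lemma scattered_intervals_countable P R : isset P -> isset R -> partially_ordered P R ->
  (~ exists f, isset f /\ is_func rational P f /\
    forall a b x y, f (pr a x) /\ f (pr b y) -> (rle a b <-> R (pr x y))) ->
  (~ exists A, isset A /\ is_antichain P R A /\ is_infinite A) ->
  exists J, isset J /\
    forall I, isset I -> is_initial P R I -> exists n, forall x, I x <-> J (pr x n).
Proof.
  intros HP HR PO SC AC.
  (* [intervals_countable] expects the order as a set of pairs. *)
  assert (E : forall a b, (exists a' b', pr a b = pr a' b' /\ rle a' b') <-> rle a b).
  { intros a b. split; [|now exists a, b].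
    intros (a' & b' & E & H). now apply pr_inj in E as [<- <-]. }
  apply (intervals_countable rational (fun z => exists a b, z = pr a b /\ rle a b) P R);
    auto.
  - apply comprehension. unfold rational, rle. solve_def.
  - apply comprehension. unfold rle. solve_def.
  - intros i Hi. apply E, Hi.
  - intros i j k _ _ _. rewrite !E. apply rle_trans.
  - intros i j Qi Qj. rewrite !E. now apply rle_antisym.
  - intros i j [Qi _] [Qj _]. rewrite !E. now apply rle_total.
  - intros (f & Hf & F & H). apply SC. exists f. split; auto. split; auto.
    intros a b x y Hab. rewrite <- (H a b x y Hab). symmetry. apply E.
Qed.

End Model.

(** * Return to provability *)

Theorem theorem4p7 :
  ATR0 ⊢
    alls (alls (let P := 1%nat in let R := 0%nat in
      partial_order P R /\ scattered P R /\ no_infinite_antichain P R -->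
      countably_many_initial_intervals P R)).
Proof.
  apply completeness. intros M Mn Mm. cbv zeta. intros P HP R HR.
  (* The meaning of the formula in [M]; the [sat_] lemmas bridge the encoding of the connectives by
     implication and falsity. *)
  cut (partially_ordered M P R /\
    (~ exists f, isset M f /\ is_func M (rational M) P f /\
      forall a b x y, f (pr M a x) /\ f (pr M b y) -> (rle M a b <-> R (pr M x y))) /\
    (~ exists A, isset M A /\ is_antichain M P R A /\ is_infinite M A) ->
    exists J, isset M J /\ forall I, isset M I -> is_initial M P R I ->
      exists n, forall x, I x <-> J (pr M x n)).
  2:{ intros (H1 & H2 & H3). now apply scattered_intervals_countable. }
  apply sat_imp; [apply sat_and; [|apply sat_and]|].
  - unfold partial_order, partially_ordered. repeat sat_step.
  - unfold scattered, is_func, func. apply sat_neg, sat_exs. intros f Hf.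
    apply sat_and; [apply sat_and|].
    + repeat sat_step. apply sat_isQ.
    + apply sat_alln; intros x. apply sat_imp; [apply sat_isQ|]. repeat sat_step.
    + do 4 (apply sat_alln; intros ?). apply sat_imp; [repeat sat_step|].
      apply sat_iff; [|reflexivity]. apply sat_qle.
  - unfold no_infinite_antichain, is_antichain, is_infinite, antichain, infinite.
    repeat sat_step.
  - unfold countably_many_initial_intervals, is_initial, initial_interval.
    repeat sat_step.
Qed.
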